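(* For $p>0$ and $x>0$ let $\zeta^{\ast}(p,x)=\sum_{k=0}^\infty\frac{(-1)^k}{(k+x)^p}$ be the alternating Hurwitz zeta function. Let $n\ge 2$ and let $\boldsymbol{p}=(p_1,\dots,p_n)$, $\boldsymbol{q}=(q_1,\dots,q_n)\in(0,\infty)^n$ satisfy $\boldsymbol{p}\prec\boldsymbol{q}$. For real $\theta<\min\{p_n,q_n\}$ put $$\mathcal{D}_\theta(x)=\prod_{j=1}^n\zeta^{\ast}(p_j,x)-\left(\prod_{j=1}^n\frac{\Gamma(p_j-\theta)\Gamma(q_j)}{\Gamma(q_j-\theta)\Gamma(p_j)}\right)\prod_{j=1}^n\zeta^{\ast}(q_j,x).$$ If $0\le\theta<\min\{p_n,q_n\}$, then $x\mapsto\mathcal{D}_\theta(x)$ is completely monotonic on $(0,\infty)$; if $\theta\le\theta_0=-0.439228\ldots$, then $x\mapsto-\mathcal{D}_\theta(x)$ is completely monotonic on $(0,\infty)$. Consequently, if $0\le\vartheta<\min\{p_n,q_n\}$ and $\theta\le\theta_0$, then the double inequality $$\prod_{j=1}^n\frac{\Gamma(p_j-\vartheta)\Gamma(q_j)}{\Gamma(q_j-\vartheta)\Gamma(p_j)}<\frac{\prod_{j=1}^n\zeta^{\ast}(p_j,x)}{\prod_{j=1}^n\zeta^{\ast}(q_j,x)}<\prod_{j=1}^n\frac{\Gamma(p_j-\theta)\Gamma(q_j)}{\Gamma(q_j-\theta)\Gamma(p_j)}$$ holds for all $x>0$, where the lower bound for $\vartheta=0$ is the best possible (it cannot be replaced by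 a larger constant).
   Context: The constant $\theta_0$ is $\theta_0=-\frac{t_0^2e^{t_0}}{(e^{t_0}+1)^2}=-0.439228\ldots$, where $t_0=2.399357\ldots$ is the unique solution of $te^t-2e^t-t-2=0$ on $(0,\infty)$. A function $h$ is completely monotonic on an interval $I$ if it has derivatives of all orders on $I$ and $(-1)^m h^{(m)}(x)\ge 0$ for all integers $m\ge 0$ and all $x\in I$. For $x=(x_1,\dots,x_n)$ and $y=(y_1,\dots,y_n)$ in $\mathbb{R}^n$, $y\prec x$ means: $x\ne y$, $x_1\ge x_2\ge\cdots\ge x_n$, $y_1\ge y_2\ge\cdots\ge y_n$, $\sum_{j=1}^{m}x_j\ge\sum_{j=1}^{m}y_j$ for $m=1,\dots,n-1$, and $\sum_{j=1}^n x_j=\sum_{j=1}^n y_j$. *)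

(* Defs.v *)
(* MathComp-Analysis, over an arbitrary R : realType. *)
From HB Require Import structures.
From mathcomp Require Import all_boot all_order all_algebra.
From mathcomp Require Import all_classical all_reals all_analysis.
From mathcomp Require Import ring lra.
Import Order.TTheory GRing.Theory Num.Theory.
Import numFieldNormedType.Exports.

Set Implicit Arguments.
Unset Strict Implicit.
Unset Printing Implicit Defensive.

Local Open Scope classical_set_scope.
Local Open Scope ring_scope.

Definition t0_eq (R : realType) (t : R) : Prop :=
  0 < t /\ t * expR t - 2 * expR t - t - 2 = 0.

(* [get] picks a point of a set; [t0_unique] shows that this set is a
   singleton. *)
Definition t0 (R : realType) : R := get [set t : R | t0_eq t].

Definition theta0 (R : realType) : R :=
  - (t0 R ^+ 2 * expR (t0 R) / (expR (t0 R) + 1) ^+ 2).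

(* Intended for s > 0, where the integral is finite. *)
Definition Gamma (R : realType) (s : R) : R :=
  Rintegral (@lebesgue_measure R) `]0, +oo[%classic
    (fun t : R => t `^ (s - 1) * expR (- t)).

(* The series converges (conditionally when p <= 1) for p > 0 and x > 0, so
   [limn] is then its sum. *)
Definition alt_hurwitz_zeta (R : realType) (p x : R) : R :=
  limn (series (fun k : nat => (-1) ^+ k / (k%:R + x) `^ p)).

(* Library derivatives are two-sided, so this is meant for open intervals. They
   are total functions, so their existence is stated separately: all
   derivatives, derive1n 0 h = h included, are required to be derivable. *)
Definition completely_monotonic (R : realType) (I : interval R) (h : R -> R) :
    Prop :=
  forall (m : nat) (x : R), x \in I ->
    derivable (derive1n m h) x 1 /\ 0 <= (-1) ^+ m * derive1n m h x.

(* [majorized y x] is y \prec x; the coordinates x_1, ..., x_n are x 0 j for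
   j : 'I_n, so that x_1 + ... + x_m is the sum over the j with j < m. *)
Definition majorized (R : realType) (n : nat) (y x : 'rV[R]_n) : Prop :=
  [/\ x <> y,
      (forall i j : 'I_n, (i <= j)%N -> x 0 j <= x 0 i),
      (forall i j : 'I_n, (i <= j)%N -> y 0 j <= y 0 i),
      (forall m : nat, (1 <= m <= n.-1)%N ->
         \sum_(j < n | (j < m)%N) y 0 j <= \sum_(j < n | (j < m)%N) x 0 j) &
      \sum_(j < n) x 0 j = \sum_(j < n) y 0 j].

Definition Gamma_coef (R : realType) (n : nat) (p q : 'rV[R]_n) (theta : R) : R :=
  \prod_(j < n) (Gamma (p 0 j - theta) * Gamma (q 0 j) /
                 (Gamma (q 0 j - theta) * Gamma (p 0 j))).

Definition Dfun (R : realType) (n : nat) (p q : 'rV[R]_n) (theta x : R) : R :=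
  \prod_(j < n) alt_hurwitz_zeta (p 0 j) x
  - Gamma_coef p q theta * \prod_(j < n) alt_hurwitz_zeta (q 0 j) x.

Lemma t0_unique (R : realType) : exists! t : R, t0_eq t.
Proof.
have gt2 (t : R) : t0_eq t -> 2 < t.
  case=> t_gt0 e; rewrite ltNge; apply/negP => t_le2.
  have et := expR_gt0 t; nra.
have inj (s t : R) : s < t -> t0_eq s -> t0_eq t -> False.
  move=> st hs ht.
  have s2 := gt2 _ hs; have t2 := gt2 _ ht.
  case: hs => _ es; case: ht => _ et.
  have lt_e : expR s < expR t by rewrite ltr_expR.
  have : (t - 2) * ((s - 2) * expR s) < (t - 2) * ((s - 2) * expR t).
    by rewrite !ltr_pM2l ?subr_gt0.
  have -> : (s - 2) * expR s = s + 2 by lra.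
  have -> : (t - 2) * ((s - 2) * expR t) = (s - 2) * (t + 2).
    have -> : t + 2 = (t - 2) * expR t by lra.
    ring.
  nra.
pose f (t : R) := t * expR t - 2 * expR t - t - 2.
have cf : {within `[2, 4], continuous f}.
  apply: continuous_subspaceT => t; rewrite /f.
  apply: cvgB; last exact: cvg_cst.
  apply: cvgB; last exact: cvg_id.
  apply: cvgB; apply: cvgM; [exact: cvg_id|exact: continuous_expR
    |exact: cvg_cst|exact: continuous_expR].
have f2 : f 2 = -4 by rewrite /f; lra.
have f4 : 0 < f 4 by have := expR_ge1Dx (4 : R); rewrite /f; lra.
have [] := @IVT R f 2 4 0 _ cf _; first by lra.
  by rewrite f2 ge_min le_max; apply/andP; split; apply/orP; [left|right]; lra.
move=> c; rewrite in_itv /= => /andP[c2 _] fc.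
have hc : t0_eq c by split => //; lra.
exists c; split=> // t ht.
by case: (ltgtP c t) => // lt; [case: (inj c t)|case: (inj t c)].
Qed.

Lemma t0P (R : realType) : t0_eq (t0 R).
Proof. by have [t [ht _]] := t0_unique R; exact: (getI ht). Qed.

(* Main.v *)
Require Import Defs.
From mathcomp Require Import all_boot all_order all_algebra.
From mathcomp Require Import all_classical all_reals all_analysis.
From mathcomp Require Import measurable_realfun ring lra.
Import Order.TTheory GRing.Theory Num.Theory.
Import numFieldNormedType.Exports.

(** Put g(t) = 1 / (1 + e^-t) and F_p(x) = int_0^oo t^(p-1) g(t) e^(-xt) dt.
    As g(t) (1 + e^-t) = 1, one has F_p(x) + F_p(x+1) = Gamma(p) x^-p, so the
    alternating series telescopes to zeta*(p,x) = F_p(x) / Gamma(p)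
    ([alt_hurwitz_zetaE]).  With phi_p = F_p / Gamma(p - theta), the function
    D_theta is a positive multiple of prod_j phi_(p_j) - prod_j phi_(q_j), and
    the question becomes how products of the phi behave under majorization.

    Two factors.  Substituting s = t r and then t = T / (1 + r) in the double
    integral for F_a(x) F_b(x) exhibits it as the Laplace transform of
    T^(a+b-1) K(T), where K(T) integrates g(A) g(B) with A = T / (1 + r) and
    B = T r / (1 + r) against r^(b-1) (1 + r)^-(a+b) ([laplace_product]).
    Adding the same formula with a and b exchanged turns this weight into a
    measure in r that is invariant under r -> 1/r.  Up to a power of T the new
    integrand is the product of a symmetrised beta density with parameters
    a - theta and b - theta, of mass
    2 Gamma(a - theta) Gamma(b - theta) / Gamma(a + b - 2 theta), and of
    W(r) = w(A) w(B), where w(t) = t^theta g(t).  So it remains to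
    compare means of W under beta laws with the same parameter sum.  The ratio
    of two such symmetrised densities is a ratio of hyperbolic cosines in ln r,
    hence monotone in |ln r|; if W is monotone in |ln r| as well, Chebyshev's
    integral inequality decides the comparison for every T
    ([chebyshev_integral], [kernel_mass_lt]).  A difference of Laplace
    transforms of ordered functions is the Laplace transform of a nonnegative
    function, hence completely monotonic, and it is positive because the order
    is strict.

    The weight.  W decreases in |ln r| when ln w is concave and increases when
    ln w is convex.  For theta >= 0 the first alternative holds, and the
    inequality between products is elementary ([split_weight_lt_ge0]).
    As (ln w)'' = - theta / t^2 - e^t / (e^t + 1)^2, the second one holds when
    - theta is at least the maximum of t^2 e^t / (e^t + 1)^2.  This maximum is
    attained at t0 only and equals - theta0: writing t = 2 h, the quotient is
    (h / cosh h)^2, the equation of t0 says h0 tanh h0 = 1, and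
    cosh h >= h sinh h0 is the tangent line inequality for cosh at h0
    ([logistic_curvature_lt], [split_weight_lt_le_theta0]).

    Many factors.  If p is majorized by q, the largest entry p_1 of p satisfies
    q_b <= p_1 <= q_1 for some b; the two-factor comparison replaces (q_1, q_b)
    by (p_1, q_1 + q_b - p_1), after which p_1 is cancelled and one recurses
    ([majorized_dom]).

    Sharpness.  For x -> 0+ the product x^p zeta*(p,x) tends to 1, so the ratio
    of the two products tends to 1, the value of the coefficient at theta = 0
    ([lower_bound_sharp]). *)

Set Implicit Arguments.
Unset Strict Implicit.
Unset Printing Implicit Defensive.
Local Open Scope classical_set_scope.
Local Open Scope ring_scope.

(** * Dilations and iterated integrals on the half-line *)

Section half_line.
Context {R : realType}.
Local Notation mu := (@lebesgue_measure R).
Local Notation D := (`]0%R, +oo[%classic : set R).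

Lemma half_lineP (x : R) : D x <-> 0 < x.
Proof. by rewrite /= in_itv /= andbT. Qed.

Lemma measurable_half_line : measurable D.
Proof. exact: measurable_itv. Qed.

(** The measure A |-> c * mu (A / c), which turns out to be mu itself. *)
Let dilated (c : R) (c0 : 0 < c) : {measure set (measurableTypeR R) -> \bar R}.
Proof.
apply: (mscale (NngNum (ltW c0)) (pushforward mu ( *%R c : R -> measurableTypeR R))).
exact: mulrl_measurable.
Defined.

(** It suffices to compare both measures on half-open intervals, which generate
    the Borel sets. *)
Lemma lebesgue_measure_dilation (c : R) : 0 < c -> forall A, measurable A ->
  (c%:E * mu (( *%R c) @^-1` A) = mu A)%E.
Proof.
move=> c0 A mA; apply/esym.
pose nu := dilated c0.
transitivity (nu A); last by rewrite /= /mscale/=.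
apply: lebesgue_measure_unique mA => X [[a b] _ <-].
rewrite /= /mscale /= /pushforward.
have -> : [set` `]a, b]] = (`]a, b])%classic by [].
have -> : *%R c @^-1` `]a, b]%classic = `](a / c), (b / c)]%classic.
  apply/seteqP; split => x /=; rewrite !in_itv /=.
    by rewrite ltr_pdivrMr // ler_pdivlMr // mulrC.
  by rewrite ltr_pdivrMr // ler_pdivlMr // mulrC.
rewrite !lebesgue_measure_itv /= !lte_fin ltr_pM2r ?invr_gt0 //.
case: ifP => _; last by rewrite mule0.
rewrite !EFinN -!EFinB -EFinM; congr (_%:E); field; exact: lt0r_neq0.
Qed.

(** The change of variables is carried out at the level of measures, so that no
    regularity of the integrand at 0 is required; the integrands below are
    unbounded there when an exponent is smaller than 1. *)
Lemma integral_dilation (c : R) (f : R -> R) : 0 < c ->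
  measurable_fun setT f -> (forall t, 0 < t -> 0 <= f t) ->
  (\int[mu]_(t in D) (c * f (c * t))%:E = \int[mu]_(t in D) (f t)%:E)%E.
Proof.
move=> c0 mf f0.
have mcf : measurable_fun D (EFin \o (f \o *%R c)).
  apply/measurable_EFinP; apply: measurable_funTS.
  by apply: measurableT_comp => //; exact: mulrl_measurable.
pose nu := dilated c0.
transitivity (\int[nu]_(t in D) (f t)%:E)%E; last first.
  apply: eq_measure_integral => A mA _.
  exact: lebesgue_measure_dilation c0 _ mA.
rewrite ge0_integral_mscale //=; last 2 first.
- by apply/measurable_EFinP; exact: measurable_funTS.
- by move=> t /half_lineP t0; rewrite lee_fin f0.
rewrite ge0_integral_pushforward; last 4 first.
- exact: mulrl_measurable.
- exact: measurable_half_line.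
- by apply/measurable_EFinP; exact: measurable_funTS.
- by move=> t; rewrite inE => /half_lineP t0; rewrite lee_fin f0.
have -> : *%R c @^-1` D = D.
  by apply/seteqP; split => x; rewrite /= !in_itv /= !andbT pmulr_rgt0.
rewrite -ge0_integralZl_EFin //= ?ltW //.
by move=> t /half_lineP t0; rewrite lee_fin f0 // mulr_gt0.
Qed.

Lemma integral_half_line_mkcond (f : R -> \bar R) :
  (\int[mu]_(t in D) f t = \int[mu]_t (f t * (\1_D t)%:E))%E.
Proof.
rewrite integral_mkcond; apply: eq_integral => x _ /=.
rewrite patchE; case: ifP => xD; by rewrite indicE xD /= ?mule1 ?mule0.
Qed.

(** Tonelli's theorem concerns integrals over full spaces, hence the indicator
    of the quadrant as a factor. *)
Lemma measurable_indic2 (F : R * R -> R) : measurable_fun setT F ->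
  measurable_fun setT (fun z : R * R => (F z * \1_D z.1 * \1_D z.2)%:E).
Proof.
move=> mF; apply/measurable_EFinP.
have mD : measurable_fun setT (\1_D : R -> R) by exact: measurable_indic.
apply: measurable_funM; last exact: (measurableT_comp mD measurable_snd).
by apply: measurable_funM => //; exact: (measurableT_comp mD measurable_fst).
Qed.

Let indic2_ge0 (F : R * R -> R) :
  (forall x y, 0 < x -> 0 < y -> 0 <= F (x, y)) ->
  forall z, (0 <= (F z * \1_D z.1 * \1_D z.2)%:E)%E.
Proof.
move=> F0 [x y]; rewrite lee_fin !indicE /=.
case: (boolP (x \in D)) => [|_]; last by rewrite mulr0 mul0r.
case: (boolP (y \in D)) => [|_]; last by rewrite mulr0.
by rewrite !inE => /half_lineP y0 /half_lineP x0; rewrite !mulr1 F0.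
Qed.

Let integral_indic2 (F : R * R -> R) (x : R) :
  (forall x y, 0 < x -> 0 < y -> 0 <= F (x, y)) ->
  ((\int[mu]_(y in D) (F (x, y))%:E) * (\1_D x)%:E
   = \int[mu]_y (F (x, y) * \1_D x * \1_D y)%:E)%E.
Proof.
move=> F0; rewrite integral_half_line_mkcond [in LHS]indicE [in RHS]indicE.
case: (boolP (x \in D)) => xD /=.
  rewrite mule1; apply: eq_integral => y _ /=; by rewrite mulr1 EFinM.
by rewrite mule0 integral0_eq // => y _; rewrite mulr0 mul0r.
Qed.

Lemma tonelli_half_line (F : R * R -> R) : measurable_fun setT F ->
  (forall x y, 0 < x -> 0 < y -> 0 <= F (x, y)) ->
  (\int[mu]_(x in D) \int[mu]_(y in D) (F (x, y))%:E =
   \int[mu]_(y in D) \int[mu]_(x in D) (F (x, y))%:E)%E.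
Proof.
move=> mF F0.
rewrite integral_half_line_mkcond [RHS]integral_half_line_mkcond.
under eq_integral do rewrite integral_indic2 //.
have /= := fubini_tonelli (m1 := mu) (m2 := mu)
  (fun z => (F z * \1_D z.1 * \1_D z.2)%:E) (measurable_indic2 mF) (indic2_ge0 F0).
move=> ->.
apply: eq_integral => y _.
rewrite (@integral_indic2 (fun z => F (z.2, z.1))) //=; last by move=> *; exact: F0.
by apply: eq_integral => x _; rewrite mulrAC.
Qed.

Lemma measurable_half_line_integral (F : R * R -> R) : measurable_fun setT F ->
  (forall x y, 0 < x -> 0 < y -> 0 <= F (x, y)) ->
  measurable_fun D (fun x => \int[mu]_(y in D) (F (x, y))%:E)%E.
Proof.
move=> mF F0.
have := measurable_fun_fubini_tonelli_F (m2 := mu)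
  (fun z => (F z * \1_D z.1 * \1_D z.2)%:E) (measurable_indic2 mF) (indic2_ge0 F0).
move/(measurable_funTS (D := D)).
apply: eq_measurable_fun => x xD; rewrite /fubini_F /= -integral_indic2 //.
by rewrite indicE xD mule1.
Qed.

End half_line.

(** * The Gamma integral and strict monotonicity of integrals *)

(** Decides measurability of the explicit integrands of this file: products and
    sums of powers, exponentials and one further function whose measurability is
    a hypothesis. *)
Ltac measurability :=
  repeat first
    [ exact: measurable_cst | exact: measurable_id | exact: measurable_fst
    | exact: measurable_snd | done
    | exact: (measurableT_comp (measurable_powR _))
    | exact: (measurableT_comp (@measurable_expR _))
    | apply: measurable_funM | apply: measurable_funD
    | apply: measurable_funN
    | apply: (measurableT_comp (measurable_powR _))
    | apply: (measurableT_comp (@measurable_expR _))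
    | match goal with mw : measurable_fun setT _ |- _ =>
        first [exact: (measurableT_comp mw) | apply: (measurableT_comp mw)] end ].

Section gamma.
Context {R : realType}.
Local Notation mu := (@lebesgue_measure R).
Local Notation D := (`]0%R, +oo[%classic : set R).

(** The fundamental theorem of calculus on [1/(n+2), n+2] bounds every truncated
    integral by M, and monotone convergence passes to the half-line.  Bounds on
    the increments of F replace limits of F at 0 and at infinity. *)
Lemma integral_half_line_derive_le (f F : R -> R) (M : R) :
  measurable_fun setT f ->
  (forall t : R, 0 < t -> is_derive t 1 F (f t)) ->
  (forall t : R, 0 < t -> {for t, continuous f}) ->
  (forall t, 0 < t -> 0 <= f t) -> (forall s t, 0 < s -> s < t -> F t - F s <= M) ->
  (\int[mu]_(t in D) (f t)%:E <= M%:E)%E.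
Proof.
move=> mf dF cf f0 FM.
pose A (n : nat) : set R := `[(n.+2%:R)^-1, n.+2%:R]%classic.
have DA : D = \bigcup_n A n.
  apply/seteqP; split => [x /half_lineP x0 | x [n _]].
    have [N hN] : exists n : nat, x <= n%:R /\ x^-1 <= n%:R.
      exists (maxn (Num.bound x) (Num.bound x^-1)); split.
        rewrite (le_trans (ltW (archi_boundP (ltW x0)))) // ler_nat leq_maxl //.
      rewrite (le_trans (ltW (archi_boundP _))) ?invr_ge0 ?(ltW x0) //.
      by rewrite ler_nat leq_maxr.
    exists N => //; rewrite /A /= in_itv /=; apply/andP; split.
      rewrite -[leRHS]invrK lef_pV2 ?posrE ?invr_gt0 ?ltr0n //.
      by apply: le_trans hN.2 _; rewrite ler_nat; apply: leqW.
    by apply: le_trans hN.1 _; rewrite ler_nat; apply: leqW.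
  rewrite /A /= in_itv /= => /andP[h _]; apply/half_lineP.
  by apply: lt_le_trans h; rewrite invr_gt0 ltr0n.
rewrite DA.
have cv : (\int[mu]_(t in A n) (f t)%:E @[n --> \oo] -->
    \int[mu]_(t in \bigcup_n A n) (f t)%:E)%E.
  apply: ge0_nondecreasing_set_cvg_integral.
- move=> m n mn; apply/subsetPset => x; rewrite /A /= !in_itv /= => /andP[h1 h2].
  apply/andP; split; last by apply: le_trans h2 _; rewrite ler_nat.
  by apply: le_trans h1; rewrite lef_pV2 ?posrE ?ltr0n // ler_nat.
- by move=> n; exact: measurable_itv.
- by move=> n; apply/measurable_EFinP; exact: measurable_funTS.
- move=> n x; rewrite /A /= in_itv /= => /andP[h _]; rewrite lee_fin f0 //.
  by apply: lt_le_trans h; rewrite invr_gt0 ltr0n.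
apply: (cvge_to_le cv); apply: nearW => n; rewrite /A.
have n0 : 0 < (n.+2%:R : R)^-1 by rewrite invr_gt0 ltr0n.
have lt : (n.+2%:R : R)^-1 < n.+2%:R.
  by apply: (@lt_trans _ _ 1); rewrite ?invf_lt1 ?ltr0n // ltr1n.
have pos x : x \in `[(n.+2%:R : R)^-1, n.+2%:R] -> 0 < x.
  by rewrite in_itv /= => /andP[h _]; apply: lt_le_trans h.
have cF x : 0 < x -> {for x, continuous F}.
  move=> x0; apply: differentiable_continuous; apply/derivable1_diffP.
  by have [] := dF x x0.
rewrite (@continuous_FTC2 _ f F) //.
- by rewrite -EFinB lee_fin; exact: FM.
- apply: continuous_in_subspaceT => x; rewrite inE => /pos; exact: cf.
- split.
  + move=> x hx; have [] // := dF x; apply: pos.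
    by move: hx; rewrite !in_itv /= => /andP[/ltW -> /ltW ->].
  + by apply: cvg_at_right_filter; exact: cF.
  + by apply: cvg_at_left_filter; apply: cF; rewrite ltr0n.
- move=> x hx; rewrite derive1E; have [] // := dF x; apply: pos.
  by move: hx; rewrite !in_itv /= => /andP[/ltW -> /ltW ->].
Qed.

(** From v <= e^v at v = c u / q, raised to the power q. *)
Lemma powR_expR_bound (c q : R) : 0 < c -> 0 < q ->
  exists2 C : R, 0 < C & forall u : R, 0 < u -> u `^ q <= C * expR (c * u).
Proof.
move=> c0 q0; exists ((q / c) `^ q); first by rewrite powR_gt0 // divr_gt0.
move=> u u0.
have -> : c * u = (u / (q / c)) * q.
  by rewrite invf_div mulrA divfK ?lt0r_neq0 // mulrC.
have -> : expR (u / (q / c) * q) = expR (u / (q / c)) `^ q.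
  by rewrite /powR gt_eqF ?expR_gt0 // expRK mulrC.
rewrite -powRM ?expR_ge0 ?divr_ge0 ?(ltW c0) ?(ltW q0) //.
rewrite ge0_ler_powR ?(ltW q0) // ?nnegrE ?(ltW u0) //.
  by rewrite mulr_ge0 ?expR_ge0 // divr_ge0 ?(ltW c0) ?(ltW q0).
rewrite -ler_pdivrMl ?divr_gt0 // mulrC.
by apply: le_trans (expR_ge1Dx _); rewrite lerDr.
Qed.

Lemma measurable_powR_mul_expR (p c : R) :
  measurable_fun setT (fun t : R => t `^ p * expR (- (c * t))).
Proof. by measurability. Qed.

(** Since (1 + t)^(p+1) e^(-ct) is bounded, the integrand is dominated by a
    multiple of t^(p-1) (1 + t)^-(p+1), the derivative of the bounded function
    (t / (1 + t))^p / p.  This treats the singularity at 0 and the decay at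
    infinity together, for all p > 0. *)
Lemma gamma_integral_lty (p c : R) : 0 < p -> 0 < c ->
  (\int[mu]_(t in D) (t `^ (p - 1) * expR (- (c * t)))%:E < +oo)%E.
Proof.
move=> p0 c0.
have [C C0 HC] := @powR_expR_bound c (p + 1) c0 (addr_gt0 p0 ltr01).
pose f (t : R) := t `^ (p - 1) * (1 + t) `^ (- (p + 1)).
have mf : measurable_fun setT f by rewrite /f; measurability.
have f0 (t : R) : 0 < t -> 0 <= f t by move=> ?; rewrite mulr_ge0 ?powR_ge0.
pose F (t : R) := p^-1 * (t `^ p * (1 + t) `^ (- p)).
have fle : (\int[mu]_(t in D) (f t)%:E <= (p^-1)%:E)%E.
  apply: (@integral_half_line_derive_le f F) => //.
  - move=> t t0; have t1 : 0 < 1 + t by rewrite addr_gt0.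
    have d1 := is_derive1_powR p t0.
    have d2 : is_derive t 1 ((fun u => u `^ (- p)) \o (fun u : R => 1 + u))
       (- p * (1 + t) `^ (- p - 1) * (0 + 1)).
      by apply: is_derive1_comp; exact: is_derive1_powR.
    have d3 : is_derive t 1 F _ := is_deriveZ p^-1 (is_deriveM d1 d2).
    apply: (is_derive_eq d3); rewrite /f /GRing.scale /= add0r mulr1.
    rewrite -[X in X `^ (-p)]/(1 + t).
    have e1 : t `^ p = t `^ (p - 1) * t.
      by rewrite mulrC mulr_powRB1 // ltW.
    have e2 : (1 + t) `^ (- p) = (1 + t) `^ (- (p + 1)) * (1 + t).
      rewrite -[X in _ * X]powRr1 ?(ltW t1) // -powRD; last first.
        by rewrite (gt_eqF t1) implybT.
      by congr (_ `^ _); ring.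
    rewrite (_ : - p - 1 = - (p + 1)); last by ring.
    by rewrite e1 e2; field; exact: lt0r_neq0.
  - move=> t t0; have t1 : 0 < 1 + t by rewrite addr_gt0.
    apply: differentiable_continuous; apply/derivable1_diffP.
    apply: derivableM; first by have [] := is_derive1_powR (p - 1) t0.
    have d2 : is_derive t 1 ((fun u => u `^ (- (p+1))) \o (fun u : R => 1 + u))
       (- (p + 1) * (1 + t) `^ (- (p+1) - 1) * (0 + 1)).
      by apply: is_derive1_comp; exact: is_derive1_powR.
    by have [] := d2.
  - move=> s t s0 st; have t0 := lt_trans s0 st.
    have : 0 <= F s by rewrite mulr_ge0 ?invr_ge0 ?(ltW p0) // mulr_ge0 ?powR_ge0.
    suff : F t <= p^-1 by lra.
    rewrite /F ger_pMr ?invr_gt0 // powRN ler_pdivrMr ?powR_gt0 ?addr_gt0 // mul1r.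
    by rewrite ge0_ler_powR ?nnegrE; lra.
have hC : (0 <= C * expR c)%R by rewrite mulr_ge0 ?expR_ge0 // ltW.
apply: (@le_lt_trans _ _ (\int[mu]_(t in D) ((C * expR c) * f t)%:E)%E).
  apply: ge0_le_integral => //.
  - by move=> t _; rewrite lee_fin mulr_ge0 ?powR_ge0 ?expR_ge0.
  - by apply/measurable_EFinP; apply: measurable_funTS; measurability.
  - by apply/measurable_EFinP; apply: measurable_funTS; measurability.
  - move=> t /half_lineP t0; rewrite lee_fin /f.
    have t1 : 0 < 1 + t by rewrite addr_gt0.
    rewrite [leRHS]mulrCA ler_pM2l ?powR_gt0 // powRN ler_pdivlMr ?powR_gt0 //.
    apply: (le_trans (ler_wpM2l (expR_ge0 _) (HC _ t1))).
    rewrite mulrCA ler_pM2l // -expRD.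
    by rewrite (_ : - (c * t) + c * (1 + t) = c) //; ring.
under eq_integral do rewrite EFinM.
rewrite ge0_integralZl_EFin //; last 2 first.
- by move=> t /half_lineP t0; rewrite lee_fin f0.
- by apply/measurable_EFinP; exact: measurable_funTS.
apply: (@le_lt_trans _ _ ((C * expR c)%:E * (p^-1)%:E)%E); last by rewrite -EFinM ltry.
by rewrite lee_wpmul2l // lee_fin.
Qed.

Lemma integral_fineK (f : R -> R) : (forall t, 0 < t -> 0 <= f t) ->
  (\int[mu]_(t in D) (f t)%:E < +oo)%E ->
  (\int[mu]_(t in D) (f t)%:E = (\int[mu]_(t in D) f t)%:E)%E.
Proof.
move=> f0 fy; rewrite /Rintegral fineK // ge0_fin_numE //.
by apply: integral_ge0 => t /half_lineP t0; rewrite lee_fin f0.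
Qed.

(** If the integral vanished, so would f almost everywhere on ]a, b[, a set of
    positive measure. *)
Lemma integral_gt0 (f : R -> \bar R) (a b : R) : measurable_fun D f ->
  (forall t : R, (0 < t)%R -> 0 <= f t)%E -> 0 <= a -> a < b ->
  (forall t : R, (a < t)%R -> (t < b)%R -> 0 < f t)%E -> (0 < \int[mu]_(t in D) f t)%E.
Proof.
move=> mf f0 a0 ab fab.
have f0' t : D t -> (0 <= f t)%E by move/half_lineP; exact: f0.
rewrite lt_neqAle integral_ge0 // andbT; apply/eqP => /esym f_eq0.
pose A : set R := `]a, b[%classic.
have mA : measurable A by exact: measurable_itv.
have AD : A `<=` D.
  move=> t; rewrite /A /= !in_itv /= => /andP[at_ _].
  by rewrite andbT (le_lt_trans a0 at_).
have mfA : measurable_fun A f by apply: (measurable_funS _ AD).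
have [N [mN N0 AN]] : ae_eq mu A f (cst 0).
  apply/ae_eq_integral_abs => //; apply/eqP; rewrite eq_le integral_ge0 // andbT -f_eq0.
  under eq_integral => t tA.
    rewrite gee0_abs; last by apply: f0'; apply: AD; move: tA; rewrite inE.
    over.
  exact: ge0_subset_integral.
have AN' : A `<=` N.
  move=> t At; apply: AN => /= /(_ At) ft0.
  move: At; rewrite /A /= in_itv /= => /andP[h1 h2].
  by have := fab _ h1 h2; rewrite ft0 ltxx.
have : (mu A <= 0)%E by rewrite -N0; apply: le_measure => //; rewrite inE.
by rewrite /A lebesgue_measure_itv /= lte_fin ab -EFinB lee_fin subr_le0 leNgt ab.
Qed.

(** Subtracting f, whose integral is finite, reduces this to [integral_gt0]. *)
Lemma lt_integral_half_line (f g : R -> \bar R) (a b : R) :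
  measurable_fun D f -> measurable_fun D g ->
  (forall t : R, (0 < t)%R -> 0 <= f t)%E ->
  (forall t : R, (0 < t)%R -> f t <= g t)%E ->
  (forall t : R, (0 < t)%R -> f t < +oo)%E ->
  (\int[mu]_(t in D) f t < +oo)%E -> 0 <= a -> a < b ->
  (forall t : R, (a < t)%R -> (t < b)%R -> f t < g t)%E ->
  (\int[mu]_(t in D) f t < \int[mu]_(t in D) g t)%E.
Proof.
move=> mf mg f0 fg fy Ify a0 ab fgab.
have ffin t : 0 < t -> (f t \is a fin_num)%E.
  by move=> t0; rewrite ge0_fin_numE ?fy ?f0.
have mgf : measurable_fun D (fun t => g t - f t)%E by exact: emeasurable_funB.
have gf0 t : 0 < t -> (0 <= g t - f t)%E.
  by move=> t0; rewrite sube_ge0 ?fg ?ffin.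
have -> : (\int[mu]_(t in D) g t =
    \int[mu]_(t in D) f t + \int[mu]_(t in D) (g t - f t))%E.
  rewrite -ge0_integralD //; last 2 first.
  - by move=> t /half_lineP; exact: f0.
  - by move=> t /half_lineP; exact: gf0.
  apply: eq_integral => t; rewrite inE => /half_lineP t0.
  by rewrite addeC subeK ?ffin.
rewrite lteDl; last first.
  rewrite ge0_fin_numE //.
  by apply: integral_ge0 => t /half_lineP; exact: f0.
apply: (@integral_gt0 _ a b) => // t at_ tb.
by rewrite sube_gt0 fgab.
Qed.

Lemma Gamma_integral (p c : R) : 0 < p -> 0 < c ->
  (\int[mu]_(t in D) (t `^ (p - 1) * expR (- (c * t)))%:E
   = (c `^ (- p) * Gamma p)%:E)%E.
Proof.
move=> p0 c0.
have EG : (\int[mu]_(t in D) (t `^ (p - 1) * expR (- t))%:E = (Gamma p)%:E)%E.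
  rewrite /Gamma integral_fineK //.
    by move=> t _; rewrite mulr_ge0 ?powR_ge0 ?expR_ge0.
  have := gamma_integral_lty p0 ltr01.
  by under eq_integral do rewrite mul1r.
have pos t : 0 < t -> 0 <= t `^ (p - 1) * expR (- (c * t)).
  by move=> _; rewrite mulr_ge0 ?powR_ge0 ?expR_ge0.
have G1 : ((Gamma p)%:E =
    (c `^ p)%:E * \int[mu]_(t in D) (t `^ (p - 1) * expR (- (c * t)))%:E)%E.
  rewrite -EG -(@integral_dilation _ c (fun t => t `^ (p - 1) * expR (- t))) //;
    last 2 first.
  - by measurability.
  - by move=> t _; rewrite mulr_ge0 ?powR_ge0 ?expR_ge0.
  transitivity (\int[mu]_(t in D)
      ((c `^ p)%:E * (t `^ (p - 1) * expR (- (c * t)))%:E))%E.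
    apply: eq_integral => t; rewrite inE => /half_lineP t0.
    rewrite -EFinM; congr (_%:E).
    by rewrite powRM ?(ltW c0) ?(ltW t0) // !mulrA mulr_powRB1 ?(ltW c0).
  apply: ge0_integralZl_EFin => //.
  - by move=> t /half_lineP t0; rewrite lee_fin pos.
  - by apply/measurable_EFinP; apply: measurable_funTS; measurability.
  - exact: powR_ge0.
move: G1; rewrite (integral_fineK pos (gamma_integral_lty p0 c0)).
move: (Rintegral _ _ _) => J; rewrite -EFinM => -[->]; congr (_%:E).
by rewrite powRN mulKf // lt0r_neq0 // powR_gt0.
Qed.

Lemma Gamma_gt0 (p : R) : 0 < p -> 0 < Gamma p.
Proof.
move=> p0; have := Gamma_integral p0 ltr01.
rewrite powR1 mul1r -lte_fin => <-.
apply: (@integral_gt0 _ 0 1) => //.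
- by apply/measurable_EFinP; apply: measurable_funTS; measurability.
- by move=> t _; rewrite lee_fin mulr_ge0 ?powR_ge0 ?expR_ge0.
- by move=> t t0 _; rewrite lte_fin mulr_gt0 ?powR_gt0 ?expR_gt0.
Qed.
End gamma.

(** * Completely monotonic functions and Laplace transforms *)

Section cm.
Context {R : realType}.
Local Notation mu := (@lebesgue_measure R).
Local Notation D := (`]0%R, +oo[%classic : set R).

(** Complete monotonicity up to order m, with minus the derivative as an
    existential witness: this form gives closure under products by induction
    through the Leibniz rule, without a formula for iterated derivatives. *)
Fixpoint cm_upto (m : nat) (h : R -> R) : Prop :=
  (forall x : R, 0 < x -> 0 <= h x) /\
  (if m is m'.+1 then
     exists2 k : R -> R, (forall x : R, 0 < x -> is_derive x 1 h (- k x)) & cm_upto m' k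
   else True).

Definition cm (h : R -> R) : Prop := forall m, cm_upto m h.

Lemma cm_upto_ge0 m h : cm_upto m h -> forall x : R, 0 < x -> 0 <= h x.
Proof. by case: m => [|m] []. Qed.

Lemma cm_uptoS m h : cm_upto m.+1 h -> cm_upto m h.
Proof.
elim: m h => [|m IH] h; first by case.
by case=> h0 [k dk] /IH hk; split=> //; exists k.
Qed.

Lemma is_derive_half_line_eq (h k : R -> R) (x d : R) : 0 < x ->
  (forall y : R, 0 < y -> h y = k y) -> is_derive x 1 h d -> is_derive x 1 k d.
Proof.
move=> x0 hk [dh vh]; have ne : \forall y \near x, h y = k y.
  by near=> y; apply: hk; near: y; exact: lt_nbhsr.
split; first by apply: near_eq_derivable dh => //.
by rewrite -vh; apply/esym; exact: near_eq_derive.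
Unshelve. all: by end_near. Qed.

Lemma eq_cm_upto m (h k : R -> R) : (forall x : R, 0 < x -> h x = k x) ->
  cm_upto m h -> cm_upto m k.
Proof.
move=> hk; case: m => [|m] [h0 hm]; split => //; try by move=> x x0; rewrite -hk ?h0.
by case: hm => l dl cl; exists l => // x x0; apply: is_derive_half_line_eq hk _; auto.
Qed.

Lemma cm_uptoD m (h k : R -> R) :
  cm_upto m h -> cm_upto m k -> cm_upto m (fun x => h x + k x).
Proof.
elim: m h k => [|m IH] h k [h0 hm] [k0 km]; split => //;
  try by move=> x x0; rewrite addr_ge0 ?h0 ?k0.
case: hm km => h' dh ch [k' dk ck]; exists (fun x => h' x + k' x); last exact: IH.
by move=> x x0; rewrite opprD; apply: is_deriveD; [exact: dh|exact: dk].
Qed.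

Lemma cm_uptoM m (h k : R -> R) :
  cm_upto m h -> cm_upto m k -> cm_upto m (fun x => h x * k x).
Proof.
elim: m h k => [|m IH] h k ch ck.
  by split => // x x0; rewrite mulr_ge0 ?(cm_upto_ge0 ch) ?(cm_upto_ge0 ck).
split; first by move=> x x0; rewrite mulr_ge0 ?(cm_upto_ge0 ch) ?(cm_upto_ge0 ck).
case: (ch) (ck) => _ [h' dh ch'] [_ [k' dk ck']].
exists (fun x => h' x * k x + h x * k' x).
  move=> x x0; have d := is_deriveM (dh x x0) (dk x x0).
  by apply: (is_derive_eq d); rewrite /GRing.scale /=; ring.
by apply: cm_uptoD; apply: IH => //; exact: cm_uptoS.
Qed.

Lemma cmD (h k : R -> R) : cm h -> cm k -> cm (fun x => h x + k x).
Proof. by move=> ch ck m; exact: cm_uptoD. Qed.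

Lemma cmM (h k : R -> R) : cm h -> cm k -> cm (fun x => h x * k x).
Proof. by move=> ch ck m; exact: cm_uptoM. Qed.

Lemma eq_cm (h k : R -> R) : (forall x : R, 0 < x -> h x = k x) -> cm h -> cm k.
Proof. by move=> hk ch m; exact: eq_cm_upto (ch m). Qed.

Lemma cm_cst (c : R) : 0 <= c -> cm (fun=> c).
Proof.
move=> c0 m; elim: m c c0 => [|m IH] c c0; split => //.
by exists (fun=> 0); [move=> x x0; rewrite oppr0; exact: is_derive_cst | exact: IH].
Qed.

(** The sign (-1)^j is carried along because each step of the induction replaces
    h by minus its derivative. *)
Lemma cm_upto_derive1n i j (h f : R -> R) (x : R) : cm_upto i.+1 h ->
  (forall y : R, 0 < y -> f y = (-1) ^+ j * h y) -> 0 < x ->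
  derivable (derive1n i f) x 1 /\ 0 <= (-1) ^+ (i + j) * derive1n i f x.
Proof.
elim: i j h f => [|i IH] j h f ch fE x0.
  case: ch => h0 [k dk _]; rewrite /= fE // mulrA -exprD add0n; split.
    have d : is_derive x 1 f ((-1) ^+ j * (- k x)).
      apply: (@is_derive_half_line_eq (fun y => (-1) ^+ j * h y)) => //.
        by move=> y y0; rewrite fE.
      exact: (is_deriveZ ((-1) ^+ j) (dk x x0)).
    by case: d.
  by rewrite -signr_odd addnn odd_double expr0 mul1r h0.
case: ch => h0 [k dk ck]; rewrite derive1Sn addSnnS.
apply: (IH j.+1 k) => // y y0; rewrite derive1E.
have d : is_derive y 1 f ((-1) ^+ j * (- k y)).
  apply: (@is_derive_half_line_eq (fun y => (-1) ^+ j * h y)) => //.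
    by move=> z z0; rewrite fE.
  exact: (is_deriveZ ((-1) ^+ j) (dk y y0)).
by case: d => _ ->; rewrite exprS mulN1r mulrN mulNr.
Qed.

Lemma cm_completely_monotonic (h : R -> R) : cm h -> completely_monotonic `]0, +oo[ h.
Proof.
move=> ch m x; rewrite in_itv /= andbT => x0.
have [] := @cm_upto_derive1n m 0 h h x (ch m.+1) _ x0; last by rewrite addn0.
by move=> y _; rewrite expr0 mul1r.
Qed.

Definition laplace (f : R -> R) (x : R) : R :=
  (\int[mu]_(t in D) (f t * expR (- (x * t))))%R.

(** Finiteness at every x > 0 makes this class stable under multiplication by t,
    which is what differentiating a Laplace transform amounts to. *)
Definition laplace_dom (f : R -> R) : Prop :=
  [/\ measurable_fun D f, (forall t : R, 0 < t -> 0 <= f t) &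
    forall x : R, 0 < x -> (\int[mu]_(t in D) (f t * expR (- (x * t)))%:E < +oo)%E].

Lemma laplaceE (f : R -> R) x : laplace_dom f -> 0 < x ->
  (\int[mu]_(t in D) (f t * expR (- (x * t)))%:E = (laplace f x)%:E)%E.
Proof.
case=> mf f0 fy x0; rewrite integral_fineK ?fy // => t t0.
by rewrite mulr_ge0 ?expR_ge0 ?f0.
Qed.

Lemma laplace_ge0 (f : R -> R) x : laplace_dom f -> 0 < x -> 0 <= laplace f x.
Proof.
case=> mf f0 fy x0; apply: Rintegral_ge0 => t /half_lineP t0.
by rewrite mulr_ge0 ?expR_ge0 ?f0.
Qed.

Lemma measurable_expRM (x : R) : measurable_fun D (fun t : R => expR (- (x * t))).
Proof. by apply: measurable_funTS; measurability. Qed.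

(** From t <= (2 / x) e^(xt/2): half of the exponential absorbs the factor t. *)
Lemma laplace_dom_mulX (f : R -> R) : laplace_dom f -> laplace_dom (fun t => t * f t).
Proof.
case=> mf f0 fy; split.
- by apply: measurable_funM => //; exact: measurable_funTS.
- by move=> t t0; rewrite mulr_ge0 ?(ltW t0) ?f0.
move=> x x0; have x2 : 0 < x / 2 by rewrite divr_gt0.
apply: (@le_lt_trans _ _
   (\int[mu]_(t in D) ((x / 2)^-1 * (f t * expR (- (x / 2 * t))))%:E)%E).
  apply: ge0_le_integral => //.
  - move=> t /half_lineP t0; rewrite lee_fin mulr_ge0 ?expR_ge0 //.
    by rewrite mulr_ge0 ?(ltW t0) ?f0.
  - apply/measurable_EFinP; apply: measurable_funM; last exact: measurable_expRM.
    by apply: measurable_funM => //; exact: measurable_funTS.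
  - apply/measurable_EFinP; apply: measurable_funM => //.
    by apply: measurable_funM; last exact: measurable_expRM.
  - move=> t /half_lineP t0; rewrite lee_fin mulrAC [leRHS]mulrCA mulrC.
    rewrite ler_wpM2l ?f0 // ler_pdivlMl // mulrA.
    rewrite [in leLHS](_ : - (x * t) = x / 2 * t * -1 + - (x / 2 * t)); last by field.
    rewrite expRD mulrA ger_pMl ?expR_gt0 // mulrN1 expRN ler_pdivrMr ?expR_gt0 //.
    by rewrite mul1r (le_trans _ (expR_ge1Dx _)) // lerDr.
under eq_integral do rewrite EFinM.
rewrite ge0_integralZl_EFin ?invr_ge0 ?(ltW x2) //.
- by rewrite lte_mul_pinfty ?lee_fin ?invr_ge0 ?(ltW x2) ?fy.
- by move=> t /half_lineP t0; rewrite lee_fin mulr_ge0 ?expR_ge0 ?f0.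
- by apply/measurable_EFinP; apply: measurable_funM => //; exact: measurable_expRM.
Qed.

Lemma laplace_integrable (f : R -> R) x : laplace_dom f -> 0 < x ->
  mu.-integrable D (EFin \o (fun t => f t * expR (- (x * t)))).
Proof.
case=> mf f0 fy x0; apply/integrableP; split.
  by apply/measurable_EFinP; apply: measurable_funM => //; exact: measurable_expRM.
under eq_integral => t tD.
  rewrite gee0_abs; last first.
    by rewrite lee_fin mulr_ge0 ?expR_ge0 ?f0 //; apply/half_lineP; rewrite -inE.
  over.
exact: fy.
Qed.

(** Differentiation under the integral sign.  On the interval ]x/2, 2x[ the
    derivative of the integrand is dominated by its absolute value at x/2. *)
Lemma is_derive_laplace (f : R -> R) (x : R) : laplace_dom f -> 0 < x ->
  is_derive x 1 (laplace f) (- laplace (fun t => t * f t) x).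
Proof.
move=> df x0; have [mf f0 fy] := df.
pose F (y t : R) := f t * expR (- (y * t)).
have dF (y t : R) : is_derive y 1 (F ^~ t) (- (t * f t * expR (- (y * t)))).
  have d1 : is_derive y 1 (fun y : R => - (y * t)) (- t).
    have -> : (fun y : R => - (y * t)) = (fun y : R => - (t * y)).
      by apply/funext => z; rewrite mulrC.
    have d : is_derive y 1 (fun y : R => - (t * y)) (- (t * 1)).
      exact: is_deriveN (is_deriveZ t (is_derive_id y 1)).
    by move: d; rewrite mulr1.
  have d2 := is_derive1_comp (is_derive_expR _) d1.
  have d3 := is_deriveZ (f t) d2.
  by apply: (is_derive_eq d3); rewrite /GRing.scale /=; ring.
have x2 : 0 < x / 2 by rewrite divr_gt0.
have E1 y t : partial1of2 F y t = - (t * f t * expR (- (y * t))).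
  by rewrite partial1of2E; have [_ ->] := dF y t.
have dtf := laplace_dom_mulX df.
have G0 y : 0 <= `|y * f y * expR (- (x / 2 * y))| by [].
have intG : mu.-integrable D (EFin \o (fun y => `|y * f y * expR (- (x / 2 * y))|)).
  have := integrable_abse (laplace_integrable dtf x2).
  exact.
have Ix : `](x / 2), (2 * x)[%classic x by rewrite /= in_itv /=; lra.
have pos y : `](x / 2), (2 * x)[%classic y -> x / 2 < y.
  by rewrite /= in_itv /= => /andP[].
have intF y : `](x / 2), (2 * x)[%classic y -> mu.-integrable D (EFin \o F y).
  by move/pos => xy; apply: laplace_integrable => //; exact: lt_trans xy.
have derF y t : `](x / 2), (2 * x)[%classic y -> D t -> derivable (F ^~ t) y 1.
  by move=> _ _; have [] := dF y t.
have Gub y t : `](x / 2), (2 * x)[%classic y -> D t ->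
    `|partial1of2 F y t| <= `|t * f t * expR (- (x / 2 * t))|.
  move=> /pos xy /half_lineP t0; rewrite E1 normrN !normrM ler_wpM2l //.
  by rewrite !ger0_norm ?expR_ge0 // ler_expR lerN2 ler_pM2r // ltW.
split.
  exact: (@derivable_under_integral R _ _ mu F D measurable_half_line x (x / 2)
    (2 * x) Ix intF derF _ G0 intG Gub).
rewrite -derive1E.
rewrite (@differentiation_under_integral R _ _ mu F D measurable_half_line x (x / 2)
  (2 * x) Ix intF derF _ G0 intG Gub).
transitivity (\int[mu]_(t in D) (-1 * (t * f t * expR (- (x * t)))))%R.
  by apply: eq_Rintegral => t _; rewrite [LHS]E1 mulN1r.
rewrite RintegralZl ?mulN1r //; exact: laplace_integrable.
Qed.

Lemma cm_laplace (f : R -> R) : laplace_dom f -> cm (laplace f).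
Proof.
move=> df m; elim: m f df => [|m IH] f df.
  by split => // x x0; exact: laplace_ge0.
split; first by move=> x x0; exact: laplace_ge0.
exists (laplace (fun t => t * f t)); last exact: IH (laplace_dom_mulX df).
by move=> x x0; exact: is_derive_laplace.
Qed.

End cm.

(** * Products of Laplace transforms *)

Section product.
Context {R : realType}.
Local Notation mu := (@lebesgue_measure R).
Local Notation D := (`]0%R, +oo[%classic : set R).

Variable w : R -> R.
Hypothesis mw : measurable_fun setT w.
Hypothesis w_gt0 : forall t, 0 < t -> 0 < w t.
Hypothesis w_le1 : forall t, 0 < t -> w t <= 1.

Definition mellin_weight (p t : R) : R := t `^ (p - 1) * w t.

(** The integrand at r that two Mellin weights produce after the substitution
    (t, s) = (T / (1 + r), T r / (1 + r)); the inverse of 1 + r is written as a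
    power. *)
Definition product_kernel (p q T r : R) : R :=
  r `^ (q - 1) * (1 + r) `^ (- (p + q)) *
  (w (T * (1 + r) `^ (-1)) * w (T * (1 + r) `^ (-1) * r)).

Lemma measurable_mellin_weight p : measurable_fun setT (mellin_weight p).
Proof. by rewrite /mellin_weight; measurability. Qed.

Lemma mellin_weight_gt0 p t : 0 < t -> 0 < mellin_weight p t.
Proof. by move=> t0; rewrite mulr_gt0 ?powR_gt0 ?w_gt0. Qed.

Lemma laplace_dom_mellin_weight p : 0 < p -> laplace_dom (mellin_weight p).
Proof.
move=> p0; split; first by apply: measurable_funTS; exact: measurable_mellin_weight.
  by move=> t t0; rewrite ltW // mellin_weight_gt0.
move=> x x0; apply: le_lt_trans (gamma_integral_lty p0 x0).
apply: ge0_le_integral => //.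
- by move=> t /half_lineP t0; rewrite lee_fin mulr_ge0 ?expR_ge0 ?ltW ?mellin_weight_gt0.
- by apply/measurable_EFinP; apply: measurable_funTS; rewrite /mellin_weight; measurability.
- by apply/measurable_EFinP; apply: measurable_funTS; measurability.
- move=> t /half_lineP t0; rewrite lee_fin ler_wpM2r ?expR_ge0 //.
  by rewrite /mellin_weight ler_piMr ?powR_ge0 ?w_le1.
Qed.

Lemma measurable_product_kernel2 p q :
  measurable_fun setT (fun z : R * R => product_kernel p q z.1 z.2).
Proof. by rewrite /product_kernel; measurability. Qed.

Lemma measurable_product_kernel p q T : measurable_fun setT (product_kernel p q T).
Proof. exact: (measurable_fun_pair2 T (measurable_product_kernel2 p q)). Qed.

Lemma product_kernel_ge0 p q T r : 0 < T -> 0 < r -> 0 <= product_kernel p q T r.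
Proof.
move=> T0 r0; have r1 : 0 < 1 + r by rewrite addr_gt0.
by rewrite mulr_ge0 // mulr_ge0 ?powR_ge0 // ltW // w_gt0 // ?mulr_gt0 ?powR_gt0.
Qed.

(** The polar substitution t + s = T, s / t = r, performed as two dilations of
    one variable at a time (s = t r for fixed t, then t = T / (1 + r) for fixed
    r), each followed by an exchange of the integrations. *)
Lemma laplace_product p q x : 0 < p -> 0 < q -> 0 < x ->
  ((laplace (mellin_weight p) x * laplace (mellin_weight q) x)%:E =
   \int[mu]_(T in D) ((T `^ (p + q - 1) * expR (- (x * T)))%:E *
                      \int[mu]_(r in D) (product_kernel p q T r)%:E))%E.
Proof.
move=> p0 q0 x0.
have dp := laplace_dom_mellin_weight p0.
have dq := laplace_dom_mellin_weight q0.
have m0 p' t : 0 < t -> 0 <= mellin_weight p' t * expR (- (x * t)).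
  by move=> t0; rewrite mulr_ge0 ?expR_ge0 ?ltW ?mellin_weight_gt0.
have mm p' : measurable_fun setT (fun t => mellin_weight p' t * expR (- (x * t))).
  by rewrite /mellin_weight; measurability.
pose G p' (t : R) := mellin_weight p' t * expR (- (x * t)).
have mGp : measurable_fun setT (G p) := mm p.
have mGq : measurable_fun setT (G q) := mm q.
(* s = t r in the inner integral *)
transitivity (\int[mu]_(t in D) \int[mu]_(r in D) (G p t * (t * G q (t * r)))%:E)%E.
  rewrite EFinM -laplaceE // -ge0_integralZr //; last 3 first.
  - by apply/measurable_EFinP; apply: measurable_funTS; exact: mm.
  - by move=> t /half_lineP t0; rewrite lee_fin m0.
  - by rewrite lee_fin laplace_ge0.
  apply: eq_integral => t; rewrite inE => /half_lineP t0.
  rewrite -(laplaceE dq x0) -(@integral_dilation _ t) //; last exact: m0.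
  rewrite -ge0_integralZl_EFin ?m0 //.
  - by move=> r /half_lineP r0; rewrite lee_fin mulr_ge0 ?(ltW t0) ?m0 ?mulr_gt0.
  - apply/measurable_EFinP; apply: measurable_funTS; rewrite /mellin_weight; measurability.
rewrite (@tonelli_half_line _ (fun z => G p z.1 * (z.1 * G q (z.1 * z.2)))); last 2 first.
- by measurability.
- by move=> t r t0 r0 /=; rewrite mulr_ge0 ?m0 // mulr_ge0 ?m0 ?(ltW t0) ?mulr_gt0.
transitivity (\int[mu]_(r in D) \int[mu]_(T in D)
   (T `^ (p + q - 1) * expR (- (x * T)) * product_kernel p q T r)%:E)%E.
  apply: eq_integral => r; rewrite inE => /half_lineP r0 /=.
  have r1 : 0 < 1 + r by rewrite addr_gt0.
  (* t = c T with c = 1 / (1 + r) *)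
  pose c := (1 + r) `^ (-1).
  have c0 : 0 < c by rewrite powR_gt0.
  have cE : c = (1 + r)^-1 by rewrite /c powR_inv1 // ltW.
  rewrite -(@integral_dilation _ c (fun t => G p t * (t * G q (t * r)))) //; last 2 first.
  - by measurability.
  - by move=> t t0 /=; rewrite mulr_ge0 ?m0 // mulr_ge0 ?m0 ?(ltW t0) ?mulr_gt0.
  apply: eq_integral => T; rewrite inE => /half_lineP T0 /=; congr (_%:E).
  rewrite /G /mellin_weight /product_kernel -/c (mulrC T c).
  have c0' := ltW c0; have T0' := ltW T0; have r0' := ltW r0.
  have e1 : expR (- (x * T)) = expR (- (x * (c * T))) * expR (- (x * (c * T * r))).
    by rewrite -expRD cE; congr expR; field; exact: lt0r_neq0.
  have e2 : (1 + r) `^ (- (p + q)) = c `^ (p - 1) * c `^ (q - 1) * c * c.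
    rewrite -mulrA -{3 4}(powRr1 c0') -!powRD ?(gt_eqF c0) ?implybT //.
    by rewrite /c -powRrM; congr (_ `^ _); ring.
  have e3 : T `^ (p + q - 1) = T `^ (p - 1) * T `^ (q - 1) * T.
    rewrite -{4}(powRr1 T0') -!powRD ?(gt_eqF T0) ?implybT //.
    by congr (_ `^ _); ring.
  rewrite e1 e2 e3 !powRM ?mulr_ge0 //; ring.
rewrite -(@tonelli_half_line _ (fun z => z.1 `^ (p + q - 1) * expR (- (x * z.1)) *
  product_kernel p q z.1 z.2)); last 2 first.
- by apply: measurable_funM; [measurability|exact: measurable_product_kernel2].
- by move=> T r T0 r0; rewrite mulr_ge0 ?product_kernel_ge0 // mulr_ge0 ?powR_ge0 ?expR_ge0.
apply: eq_integral => T; rewrite inE => /half_lineP T0 /=.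
under eq_integral do rewrite EFinM.
rewrite ge0_integralZl_EFin //.
- by move=> r /half_lineP r0; rewrite lee_fin product_kernel_ge0.
- by apply/measurable_EFinP; apply: measurable_funTS; exact: measurable_product_kernel.
- by rewrite mulr_ge0 ?powR_ge0 ?expR_ge0.
Qed.

End product.

(** * A Chebyshev inequality for integrals *)

Section chebyshev.
Context {R : realType}.
Local Notation mu := (@lebesgue_measure R).
Local Notation D := (`]0%R, +oo[%classic : set R).

Lemma integral_half_line_lin (f g : R -> R) (a b If Ig : R) :
  measurable_fun D f -> measurable_fun D g ->
  (forall t, 0 < t -> 0 <= f t) -> (forall t, 0 < t -> 0 <= g t) ->
  0 <= a -> 0 <= b ->
  (\int[mu]_(t in D) (f t)%:E = If%:E)%E -> (\int[mu]_(t in D) (g t)%:E = Ig%:E)%E ->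
  (\int[mu]_(t in D) (a * f t + b * g t)%:E = (a * If + b * Ig)%:E)%E.
Proof.
move=> mf mg f0 g0 a0 b0 EIf EIg.
under eq_integral do rewrite EFinD.
rewrite ge0_integralD //; last 4 first.
- by move=> t /half_lineP t0; rewrite lee_fin mulr_ge0 ?f0.
- by apply/measurable_EFinP; apply: measurable_funM.
- by move=> t /half_lineP t0; rewrite lee_fin mulr_ge0 ?g0.
- by apply/measurable_EFinP; apply: measurable_funM.
under eq_integral do rewrite EFinM.
under [X in (_ + X)%E]eq_integral do rewrite EFinM.
rewrite !ge0_integralZl_EFin //; last 4 first.
- by move=> t /half_lineP t0; rewrite lee_fin g0.
- by apply/measurable_EFinP.
- by move=> t /half_lineP t0; rewrite lee_fin f0.
- by apply/measurable_EFinP.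
by rewrite EIf EIg EFinD !EFinM.
Qed.

(** Multiply (e2/e1 (r) - e2/e1 (r')) (W r - W r') <= 0 by e1(r) e1(r') and
    integrate over both variables.  The four terms are kept positive by moving
    the negative ones across the inequality, so only integrals of nonnegative
    functions occur.  The function k orders the points: e2/e1 and W are monotone
    in opposite directions along it, and the last hypothesis makes the
    inequality strict for every r. *)
Lemma chebyshev_integral (k e1 e2 W : R -> R) (S1 S2 A1 A2 : R) :
  measurable_fun D e1 -> measurable_fun D e2 -> measurable_fun D W ->
  (forall r, 0 < r -> 0 < e1 r) -> (forall r, 0 < r -> 0 < e2 r) ->
  (forall r, 0 < r -> 0 < W r) ->
  (\int[mu]_(r in D) (e1 r)%:E = S1%:E)%E ->
  (\int[mu]_(r in D) (e2 r)%:E = S2%:E)%E ->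
  (\int[mu]_(r in D) (e1 r * W r)%:E = A1%:E)%E ->
  (\int[mu]_(r in D) (e2 r * W r)%:E = A2%:E)%E ->
  (forall r r', 0 < r -> 0 < r' -> k r < k r' ->
     (e2 r * e1 r' - e1 r * e2 r') * (W r - W r') < 0) ->
  (forall r r', 0 < r -> 0 < r' -> k r = k r' -> W r = W r') ->
  (forall r, 0 < r -> exists a b : R, [/\ 0 <= a, a < b &
     forall r', a < r' -> r' < b -> k r < k r']) ->
  A2 * S1 < A1 * S2.
Proof.
move=> me1 me2 mW e10 e20 W0 ES1 ES2 EA1 EA2 lt_k eq_k ex_k.
have e10' r (r0 : 0 < r) := ltW (e10 r r0).
have e20' r (r0 : 0 < r) := ltW (e20 r r0).
have W0' r (r0 : 0 < r) := ltW (W0 r r0).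
have e1W0 r : 0 < r -> 0 <= e1 r * W r by move=> r0; rewrite mulr_ge0 ?e10' ?W0'.
have e2W0 r : 0 < r -> 0 <= e2 r * W r by move=> r0; rewrite mulr_ge0 ?e20' ?W0'.
have me1W : measurable_fun D (fun r => e1 r * W r) by exact: measurable_funM.
have me2W : measurable_fun D (fun r => e2 r * W r) by exact: measurable_funM.
have A10 : 0 <= A1.
  by rewrite -lee_fin -EA1; apply: integral_ge0 => r /half_lineP; exact: e1W0.
have A20 : 0 <= A2.
  by rewrite -lee_fin -EA2; apply: integral_ge0 => r /half_lineP; exact: e2W0.
have S10 : 0 <= S1.
  by rewrite -lee_fin -ES1; apply: integral_ge0 => r /half_lineP; exact: e10'.
have S20 : 0 <= S2.
  by rewrite -lee_fin -ES2; apply: integral_ge0 => r /half_lineP; exact: e20'.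
have lt_k' r r' : 0 < r -> 0 < r' -> k r < k r' ->
    e2 r * W r * e1 r' + e1 r * (e2 r' * W r') <
    e2 r * (e1 r' * W r') + e1 r * W r * e2 r'.
  by move=> r0 r'0 /(lt_k _ _ r0 r'0); lra.
have pointwise r r' : 0 < r -> 0 < r' ->
    e2 r * W r * e1 r' + e1 r * (e2 r' * W r') <=
    e2 r * (e1 r' * W r') + e1 r * W r * e2 r'.
  move=> r0 r'0; case: (ltgtP (k r) (k r')) => h.
  - by apply: ltW; exact: lt_k'.
  - by have := lt_k _ _ r'0 r0 h; lra.
  - by rewrite (eq_k _ _ r0 r'0 h); lra.
have inner r : 0 < r ->
    (S1 * (e2 r * W r) + A2 * e1 r < A1 * e2 r + S2 * (e1 r * W r)).
  move=> r0; rewrite -lte_fin.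
  have [a [b [a0 ab kab]]] := ex_k _ r0.
  have L := integral_half_line_lin me1 me2W e10' e2W0 (e2W0 _ r0) (e10' _ r0) ES1 EA2.
  have U := integral_half_line_lin me1W me2 e1W0 e20' (e20' _ r0) (e1W0 _ r0) EA1 ES2.
  rewrite (_ : S1 * _ + A2 * _ = e2 r * W r * S1 + e1 r * A2); last by ring.
  rewrite (_ : A1 * _ + S2 * _ = e2 r * A1 + e1 r * W r * S2); last by ring.
  rewrite -L -U; apply: (@lt_integral_half_line _ _ _ a b) => //.
  - by apply/measurable_EFinP; apply: measurable_funD; exact: measurable_funM.
  - by apply/measurable_EFinP; apply: measurable_funD; exact: measurable_funM.
  - by move=> t t0; rewrite lee_fin addr_ge0 // mulr_ge0 ?e2W0 ?e10'.
  - by move=> t t0; rewrite lee_fin pointwise.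
  - by move=> t t0; rewrite ltry.
  - by rewrite L ltry.
  - move=> t at_ tb; rewrite lte_fin lt_k' ?kab //.
    exact: le_lt_trans a0 at_.
have L := integral_half_line_lin me2W me1 e2W0 e10' S10 A20 EA2 ES1.
have U := integral_half_line_lin me2 me1W e20' e1W0 A10 S20 ES2 EA1.
suff : S1 * A2 + A2 * S1 < A1 * S2 + S2 * A1 by lra.
rewrite -lte_fin -L -U; apply: (@lt_integral_half_line _ _ _ 0 1) => //.
- by apply/measurable_EFinP; apply: measurable_funD; exact: measurable_funM.
- by apply/measurable_EFinP; apply: measurable_funD; exact: measurable_funM.
- by move=> t t0; rewrite lee_fin addr_ge0 // mulr_ge0 ?e2W0 ?e10'.
- by move=> t t0; rewrite lee_fin ltW // inner.
- by move=> t t0; rewrite ltry.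
- by rewrite L ltry.
- by move=> t t0 _; rewrite lte_fin inner.
Qed.

(** The difference of the two sides, which are 2 cosh x and 2 cosh y, is
    (e^(y-x) - 1) (e^x - e^-y). *)
Lemma cosh_lt (x y : R) : - y < x -> x < y ->
  expR x + expR (- x) < expR y + expR (- y).
Proof.
move=> yx xy; rewrite -subr_gt0.
have -> : expR y + expR (- y) - (expR x + expR (- x)) =
    (expR (y - x) - 1) * (expR x - expR (- y)).
  rewrite mulrBr !mulrBl !mul1r -!expRD.
  have -> : y - x + x = y by ring.
  have -> : y - x - y = - x by ring.
  by move: (expR x) (expR y) (expR (- x)) (expR (- y)) => *; ring.
by rewrite mulr_gt0 // subr_gt0 ?ltr_expR // -expR0 ltr_expR subr_gt0.
Qed.

Lemma cosh_le (x y : R) : - y <= x -> x <= y ->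
  expR x + expR (- x) <= expR y + expR (- y).
Proof.
rewrite le_eqVlt => /predU1P[<-|yx]; first by rewrite opprK addrC.
rewrite le_eqVlt => /predU1P[->//|xy].
exact: ltW (cosh_lt yx xy).
Qed.

(** The ratio cosh (d x) / cosh (c x) increases with x >= 0: by the
    product-to-sum formula both sides become sums of two hyperbolic cosines,
    which compare termwise. *)
Lemma cosh_ratio_lt (c d x y : R) : 0 <= c -> c < d -> 0 <= x -> x < y ->
  (expR (d * x) + expR (- (d * x))) * (expR (c * y) + expR (- (c * y))) <
  (expR (c * x) + expR (- (c * x))) * (expR (d * y) + expR (- (d * y))).
Proof.
move=> c0 cd x0 xy.
have E (a b : R) : (expR a + expR (- a)) * (expR b + expR (- b)) =
    (expR (a + b) + expR (- (a + b))) + (expR (a - b) + expR (- (a - b))).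
  have -> : - (a + b) = - a + - b by ring.
  have -> : - (a - b) = - a + b by ring.
  rewrite !expRD.
  by move: (expR a) (expR b) (expR (- a)) (expR (- b)) => *; ring.
have d0 := le_lt_trans c0 cd; have y0 := le_lt_trans x0 xy.
have h1 : 0 < (d - c) * (y - x) by apply: mulr_gt0; lra.
have h2 : 0 < (d + c) * (y - x) by apply: mulr_gt0; lra.
have h3 : 0 < (d - c) * (x + y) by apply: mulr_gt0; lra.
have h4 : 0 < (d + c) * (x + y) by apply: mulr_gt0; lra.
rewrite [X in _ < X]mulrC !E; apply: ltr_leD.
  by apply: cosh_lt; lra.
by apply: cosh_le; lra.
Qed.

End chebyshev.

(** * Symmetrised kernels and beta integrals *)

Section pairs.
Context {R : realType}.
Local Notation mu := (@lebesgue_measure R).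
Local Notation D := (`]0%R, +oo[%classic : set R).

Lemma powR_sum_cosh (a b r : R) : 0 < r ->
  r `^ (b - 1) + r `^ (a - 1) = r `^ ((a + b) / 2 - 1) *
    (expR ((a - b) / 2 * `|ln r|) + expR (- ((a - b) / 2 * `|ln r|))).
Proof.
move=> r0; have E (u : R) : r `^ u = expR (u * ln r) by rewrite /powR gt_eqF.
rewrite !E mulrDr -!expRD; case: (ger0P (ln r)) => _.
  by rewrite addrC; congr (expR _ + expR _); field.
by congr (expR _ + expR _); field.
Qed.

Lemma ln_abs_lt (r s : R) : 0 < r -> 0 < s -> r + r^-1 < s + s^-1 -> `|ln r| < `|ln s|.
Proof.
move=> r0 s0; apply: contraTT; rewrite -!leNgt => sr.
have E (u : R) : 0 < u -> u + u^-1 = expR `|ln u| + expR (- `|ln u|).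
  move=> u0; case: (ger0P (ln u)) => _; first by rewrite expRN !lnK.
  by rewrite opprK expRN !lnK // addrC.
rewrite !E //; apply: cosh_le => //.
by apply: le_trans (normr_ge0 _); rewrite lerNl oppr0.
Qed.

(** Opposed pairs of exponents with a common sum differ only through
    cosh (d ln r), where d is half the difference of the exponents. *)
Lemma beta_density_ratio_lt (a1 b1 a2 b2 r s : R) : 0 < r -> 0 < s ->
  a1 + b1 = a2 + b2 -> 0 <= a1 - b1 -> a1 - b1 < a2 - b2 ->
  r + r^-1 < s + s^-1 ->
  (r `^ (b2 - 1) + r `^ (a2 - 1)) * (s `^ (b1 - 1) + s `^ (a1 - 1)) <
  (r `^ (b1 - 1) + r `^ (a1 - 1)) * (s `^ (b2 - 1) + s `^ (a2 - 1)).
Proof.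
move=> r0 s0 ab d1 d12 /(ln_abs_lt r0 s0) lt_ln.
rewrite !powR_sum_cosh // ab mulrACA [ltRHS]mulrACA ltr_pM2l; last first.
  by rewrite mulr_gt0 ?powR_gt0.
by apply: cosh_ratio_lt => //; lra.
Qed.

Section kernel.
Variable w : R -> R.
Hypothesis mw : measurable_fun setT w.
Hypothesis w_gt0 : forall t, 0 < t -> 0 < w t.
Hypothesis w_le1 : forall t, 0 < t -> w t <= 1.

(** Both orders of the factors together: for a given sum p + q the exponents then
    enter only through an even function of ln r ([powR_sum_cosh]). *)
Definition sym_kernel (p q T r : R) : R :=
  product_kernel w p q T r + product_kernel w q p T r.

Lemma sym_kernelE p q T r : sym_kernel p q T r =
  (r `^ (q - 1) + r `^ (p - 1)) * (1 + r) `^ (- (p + q)) *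
  (w (T * (1 + r) `^ (-1)) * w (T * (1 + r) `^ (-1) * r)).
Proof. by rewrite /sym_kernel /product_kernel (addrC q p) -!mulrDl. Qed.

Lemma sym_kernel_gt0 p q T r : 0 < T -> 0 < r -> 0 < sym_kernel p q T r.
Proof.
move=> T0 r0; have r1 : 0 < 1 + r by rewrite addr_gt0.
rewrite sym_kernelE mulr_gt0 //.
  by rewrite mulr_gt0 ?powR_gt0 // addr_gt0 ?powR_gt0.
by rewrite mulr_gt0 ?w_gt0 // !mulr_gt0 ?powR_gt0.
Qed.

Lemma measurable_sym_kernel p q :
  measurable_fun setT (fun z : R * R => sym_kernel p q z.1 z.2).
Proof. by apply: measurable_funD; exact: measurable_product_kernel2. Qed.

Lemma measurable_sym_kernel1 p q T : measurable_fun setT (sym_kernel p q T).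
Proof. by apply: measurable_funD; exact: measurable_product_kernel. Qed.

Lemma laplace_product_sym p q x : 0 < p -> 0 < q -> 0 < x ->
  ((2 * (laplace (mellin_weight w p) x * laplace (mellin_weight w q) x))%:E =
   \int[mu]_(T in D) ((T `^ (p + q - 1) * expR (- (x * T)))%:E *
                      \int[mu]_(r in D) (sym_kernel p q T r)%:E))%E.
Proof.
move=> p0 q0 x0.
have k0 p' q' T : 0 < T ->
    (0 <= \int[mu]_(r in D) (product_kernel w p' q' T r)%:E)%E.
  move=> T0; apply: integral_ge0 => r /half_lineP r0.
  by rewrite lee_fin product_kernel_ge0.
have mk p' q' : measurable_fun D
    (fun T => \int[mu]_(r in D) (product_kernel w p' q' T r)%:E)%E.
  apply: (@measurable_half_line_integral _ (fun z => product_kernel w p' q' z.1 z.2)).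
    exact: measurable_product_kernel2.
  by move=> T r T0 r0; exact: product_kernel_ge0.
have mf p' q' : measurable_fun D (fun T => (T `^ (p + q - 1) * expR (- (x * T)))%:E *
   \int[mu]_(r in D) (product_kernel w p' q' T r)%:E)%E.
  apply: emeasurable_funM => //; apply/measurable_EFinP; apply: measurable_funTS; measurability.
have f0 p' q' T : D T -> (0 <= (T `^ (p + q - 1) * expR (- (x * T)))%:E *
   \int[mu]_(r in D) (product_kernel w p' q' T r)%:E)%E.
  move=> /half_lineP T0; rewrite mule_ge0 ?k0 // lee_fin.
  by rewrite mulr_ge0 ?powR_ge0 ?expR_ge0.
rewrite mulr_natl mulr2n EFinD [X in (X + _ = _)%E](laplace_product mw w_gt0 w_le1) //.
rewrite mulrC (laplace_product mw w_gt0 w_le1) // (addrC q p) -ge0_integralD //;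
  try by [exact: mf | exact: f0].
apply: eq_integral => T; rewrite inE => /half_lineP T0.
rewrite -ge0_muleDr ?k0 // -ge0_integralD //.
- by move=> r /half_lineP r0; rewrite lee_fin product_kernel_ge0.
- by apply/measurable_EFinP; apply: measurable_funTS; exact: measurable_product_kernel.
- by move=> r /half_lineP r0; rewrite lee_fin product_kernel_ge0.
- by apply/measurable_EFinP; apply: measurable_funTS; exact: measurable_product_kernel.
Qed.

End kernel.

Lemma laplace_Gamma (p : R) : 0 < p -> laplace (mellin_weight (fun=> 1) p) 1 = Gamma p.
Proof.
by move=> p0; apply: eq_Rintegral => t _; rewrite /mellin_weight mulr1 mul1r.
Qed.

(** Euler's beta integral is the case of the constant weight 1 at x = 1: the
    inner integral does not depend on T, and the outer one is a Gamma
    integral. *)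
Lemma beta_integral (a b : R) : 0 < a -> 0 < b ->
  (\int[mu]_(r in D) ((r `^ (b - 1) + r `^ (a - 1)) * (1 + r) `^ (- (a + b)))%:E =
   (2 * (Gamma a * Gamma b) / Gamma (a + b))%:E)%E.
Proof.
move=> a0 b0; have ab0 : 0 < a + b by rewrite addr_gt0.
have G0 := Gamma_gt0 ab0.
set B := (\int[mu]_(r in D) _)%E.
have B0 : (0 <= B)%E.
  apply: integral_ge0 => r /half_lineP r0.
  by rewrite lee_fin mulr_ge0 ?addr_ge0 ?powR_ge0.
have E : ((2 * (Gamma a * Gamma b))%:E = (Gamma (a + b))%:E * B)%E.
  rewrite -(laplace_Gamma a0) -(laplace_Gamma b0) laplace_product_sym //.
  have := Gamma_integral ab0 ltr01; rewrite powR1 mul1r => <-.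
  transitivity (\int[mu]_(T in D) ((T `^ (a + b - 1) * expR (- (1 * T)))%:E * B))%E.
    apply: eq_integral => T _; congr (_%:E * _)%E.
    by apply: eq_integral => r _; rewrite sym_kernelE !mulr1.
  apply: ge0_integralZr => //.
  - by apply/measurable_EFinP; apply: measurable_funTS; exact: measurable_powR_mul_expR.
  - by move=> t _; rewrite lee_fin mulr_ge0 ?powR_ge0 ?expR_ge0.
(* the integral is finite, as Gamma (a + b) > 0 times it is *)
case: B B0 E => [s _ E|_|//]; last by rewrite gt0_muley ?lte_fin.
move: E; rewrite -EFinM => -[E]; congr (_%:E); rewrite E.
by rewrite mulrC mulKf ?lt0r_neq0.
Qed.

Section kernel_comparison.
Variable w : R -> R.
Hypothesis mw : measurable_fun setT w.
Hypothesis w_gt0 : forall t, 0 < t -> 0 < w t.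
Hypothesis w_le1 : forall t, 0 < t -> w t <= 1.

Definition kernel_mass (p q T : R) : R :=
  fine (\int[mu]_(r in D) (sym_kernel w p q T r)%:E)%E.

(** The integral is finite, being at most the beta integral because w <= 1. *)
Lemma kernel_massE p q T : 0 < p -> 0 < q -> 0 < T ->
  (\int[mu]_(r in D) (sym_kernel w p q T r)%:E = (kernel_mass p q T)%:E)%E.
Proof.
move=> p0 q0 T0; rewrite /kernel_mass fineK // ge0_fin_numE; last first.
  by apply: integral_ge0 => r /half_lineP r0; rewrite lee_fin ltW // sym_kernel_gt0.
apply: (@le_lt_trans _ _ (2 * (Gamma p * Gamma q) / Gamma (p + q))%:E); last exact: ltry.
rewrite -beta_integral //; apply: ge0_le_integral => //.
- by move=> r /half_lineP r0; rewrite lee_fin ltW // sym_kernel_gt0.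
- by apply/measurable_EFinP; apply: measurable_funTS; exact: measurable_sym_kernel1.
- by apply/measurable_EFinP; apply: measurable_funTS; measurability.
- move=> r /half_lineP r0; have r1 : 0 < 1 + r by rewrite addr_gt0.
  rewrite lee_fin sym_kernelE ler_piMr //.
    by rewrite mulr_ge0 ?addr_ge0 ?powR_ge0.
  by rewrite mulr_ile1 ?w_le1 ?ltW ?w_gt0 ?mulr_gt0 ?powR_gt0.
Qed.

Lemma kernel_mass_gt0 p q T : 0 < p -> 0 < q -> 0 < T -> 0 < kernel_mass p q T.
Proof.
move=> p0 q0 T0; rewrite -lte_fin -kernel_massE //; apply: (@integral_gt0 _ _ 0 1) => //.
- by apply/measurable_EFinP; apply: measurable_funTS; exact: measurable_sym_kernel1.
- by move=> r r0; rewrite lee_fin ltW // sym_kernel_gt0.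
- by move=> r r0 _; rewrite lte_fin sym_kernel_gt0.
Qed.

Lemma measurable_kernel_mass p q : measurable_fun D (kernel_mass p q).
Proof.
apply: (@measurableT_comp _ _ _ _ _ _ (@fine R)) => //.
apply: (@measurable_half_line_integral _ (fun z => sym_kernel w p q z.1 z.2)).
  exact: measurable_sym_kernel.
by move=> T r T0 r0; rewrite ltW // sym_kernel_gt0.
Qed.

End kernel_comparison.
End pairs.

(** * Comparison of kernel masses *)

Section kernel_comparison.
Context {R : realType}.
Local Notation mu := (@lebesgue_measure R).
Local Notation D := (`]0%R, +oo[%classic : set R).
Variable w : R -> R.
Hypothesis mw : measurable_fun setT w.
Hypothesis w_gt0 : forall t, 0 < t -> 0 < w t.
Hypothesis w_le1 : forall t, 0 < t -> w t <= 1.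
Local Notation kernel_mass := (kernel_mass w).

(** This is v(A) v(B) for v(t) = t^th * w(t). *)
Definition split_weight (th A B : R) : R := (A * B) `^ th * (w A * w B).

(** The sign sg treats log-concave (1) and log-convex (-1) weights together; for
    a fixed sum A + B, a larger product A * B means that A and B are closer. *)
Variables (th sg : R).
Hypothesis sg1 : sg = 1 \/ sg = -1.
Hypothesis split_weight_lt : forall A B A' B', 0 < A -> 0 < B -> 0 < A' -> 0 < B' ->
  A + B = A' + B' -> A * B < A' * B' ->
  0 < sg * (split_weight th A' B' - split_weight th A B).

(** Both kernels are of the form e * W with the same W and with e the density of
    a beta law for the parameters shifted by th; the second density is the more
    spread out one.  Chebyshev's inequality applies with k r = r + 1/r, as
    A * B = T^2 / (k r + 2). *)
Lemma kernel_mass_lt p1 q1 p2 q2 T : 0 < p1 -> 0 < q1 -> 0 < p2 -> 0 < q2 ->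
  th < p1 -> th < q1 -> th < p2 -> th < q2 -> 0 < T ->
  p1 + q1 = p2 + q2 -> 0 <= p1 - q1 -> p1 - q1 < p2 - q2 ->
  0 < sg * (kernel_mass p1 q1 T * (Gamma (p2 - th) * Gamma (q2 - th)) -
            kernel_mass p2 q2 T * (Gamma (p1 - th) * Gamma (q1 - th))).
Proof.
move=> p10 q10 p20 q20 tp1 tq1 tp2 tq2 T0 pq d1 d12.
pose e p q (r : R) := (r `^ (q - th - 1) + r `^ (p - th - 1)) *
   (1 + r) `^ (- (p - th + (q - th))).
pose W (r : R) := r `^ th * (1 + r) `^ (- (th + th)) *
   (w (T * (1 + r) `^ (-1)) * w (T * (1 + r) `^ (-1) * r)).
have me p q : measurable_fun D (e p q) by apply: measurable_funTS; measurability.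
have mW : measurable_fun D W.
  apply: measurable_funTS; rewrite /W; measurability.
have e0 p q r : 0 < r -> 0 < e p q r.
  move=> r0; have r1 : 0 < 1 + r by rewrite addr_gt0.
  by rewrite mulr_gt0 ?powR_gt0 // addr_gt0 ?powR_gt0.
have W0 r : 0 < r -> 0 < W r.
  move=> r0; have r1 : 0 < 1 + r by rewrite addr_gt0.
  by rewrite mulr_gt0 // mulr_gt0 ?powR_gt0 // w_gt0 // ?mulr_gt0 ?powR_gt0.
have eW p q r : 0 < r -> e p q r * W r = sym_kernel w p q T r.
  move=> r0; have r1 : 0 < 1 + r by rewrite addr_gt0.
  rewrite sym_kernelE /e /W.
  have -> : (1 + r) `^ (- (p + q)) =
      (1 + r) `^ (- (p - th + (q - th))) * (1 + r) `^ (- (th + th)).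
    by rewrite -powRD ?(gt_eqF r1) ?implybT //; congr (_ `^ _); ring.
  have E u : r `^ (u - 1) = r `^ (u - th - 1) * r `^ th.
    by rewrite -powRD ?(gt_eqF r0) ?implybT //; congr (_ `^ _); ring.
  rewrite (E p) (E q); ring.
have EA p q : 0 < p -> 0 < q ->
    (\int[mu]_(r in D) (e p q r * W r)%:E = (kernel_mass p q T)%:E)%E.
  move=> p0 q0; rewrite -(kernel_massE mw w_gt0 w_le1 p0 q0 T0).
  by apply: eq_integral => r; rewrite inE => /half_lineP r0; rewrite eW.
have ES p q : th < p -> th < q ->
    (\int[mu]_(r in D) (e p q r)%:E =
    (2 * (Gamma (p - th) * Gamma (q - th)) / Gamma (p - th + (q - th)))%:E)%E.
  by move=> tp tq; rewrite -beta_integral ?subr_gt0.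
pose k (r : R) := r + r^-1.
have half r : 0 < r -> [/\ 0 < T * (1 + r) `^ (-1), 0 < T * (1 + r) `^ (-1) * r,
    T * (1 + r) `^ (-1) + T * (1 + r) `^ (-1) * r = T &
    T * (1 + r) `^ (-1) * (T * (1 + r) `^ (-1) * r) = T ^+ 2 / (k r + 2)].
  move=> r0; have r1 : 0 < 1 + r by rewrite addr_gt0.
  split; rewrite ?mulr_gt0 ?powR_gt0 // powR_inv1 ?(ltW r1) //.
    by field; exact: lt0r_neq0.
  rewrite /k; field; rewrite !lt0r_neq0 //.
  by rewrite !addr_gt0 // mulr_gt0.
have k0 r : 0 < r -> 0 < k r + 2 by move=> r0; rewrite !addr_gt0 ?invr_gt0.
have WV r : 0 < r -> W r = T `^ (- (th + th)) *
    split_weight th (T * (1 + r) `^ (-1)) (T * (1 + r) `^ (-1) * r).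
  move=> r0; have r1 : 0 < 1 + r by rewrite addr_gt0.
  rewrite /W /split_weight [RHS]mulrA; congr (_ * _).
  have c0 : 0 <= (1 + r) `^ (-1) by rewrite powR_ge0.
  have T0' := ltW T0; have r0' := ltW r0.
  rewrite !powRM ?mulr_ge0 // -powRrM mulN1r.
  have -> : (1 + r) `^ (- (th + th)) = (1 + r) `^ (- th) * (1 + r) `^ (- th).
    by rewrite -powRD ?(gt_eqF r1) ?implybT //; congr (_ `^ _); ring.
  have e1 : T `^ (- (th + th)) * (T `^ th * T `^ th) = 1.
    rewrite -!powRD ?(gt_eqF T0) ?implybT // addNr powRr0 //.
  by rewrite -[LHS]mul1r -e1; ring.
have ltW_k r r' : 0 < r -> 0 < r' -> k r < k r' -> 0 < sg * (W r - W r').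
  move=> r0 r'0 kk; rewrite !WV // -mulrBr mulrCA mulr_gt0 ?powR_gt0 //.
  have [A0 B0 AB ABm] := half _ r0; have [A'0 B'0 AB' ABm'] := half _ r'0.
  apply: split_weight_lt => //; first by rewrite AB AB'.
  rewrite ABm ABm' ltr_pM2l ?exprn_gt0 // ltf_pV2 ?posrE ?k0 //.
  by rewrite ltrD2r.
(* k r = k r' leaves r = r' or r = 1/r', and then A and B are exchanged *)
have eqW_k r r' : 0 < r -> 0 < r' -> k r = k r' -> W r = W r'.
  move=> r0 r'0; rewrite /k => kk.
  have : (r - r') * (r - r'^-1) = 0.
    have r'E : r' * r'^-1 = 1 by rewrite mulfV ?lt0r_neq0.
    have rE : r * r^-1 = 1 by rewrite mulfV ?lt0r_neq0.
    have : r * (r + r^-1) = r * (r' + r'^-1) by rewrite kk.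
    by rewrite !(mulrDr, mulrDl, mulrN, mulNr) rE r'E; lra.
  move/eqP; rewrite mulf_eq0 !subr_eq0 => /orP[/eqP-> //|/eqP rr].
  rewrite !WV // /split_weight.
  have r'1 : 0 < 1 + r' by rewrite addr_gt0.
  have r1 : 0 < 1 + r by rewrite addr_gt0.
  have -> : T * (1 + r) `^ (-1) = T * (1 + r') `^ (-1) * r'.
    rewrite !powR_inv1 ?(ltW r1) ?(ltW r'1) // rr; field.
    by rewrite !lt0r_neq0 // addrC.
  have -> : T * (1 + r') `^ (-1) * r' * r = T * (1 + r') `^ (-1).
    by rewrite rr mulfK ?lt0r_neq0.
  by congr (_ * (_ `^ _ * _)); exact: mulrC.
(* every r' > k r satisfies k r' > k r *)
have k_int r : 0 < r -> exists a b : R, [/\ 0 <= a, a < b &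
     forall r', a < r' -> r' < b -> k r < k r'].
  move=> r0; have kr : 0 < k r by rewrite addr_gt0 ?invr_gt0.
  exists (k r), (k r + 1); split; [exact: ltW | by rewrite ltrDl |].
  move=> r' h _; apply: (lt_trans h); rewrite ltrDl invr_gt0.
  exact: lt_trans h.
have e_k r r' : 0 < r -> 0 < r' -> k r < k r' ->
    e p2 q2 r * e p1 q1 r' < e p1 q1 r * e p2 q2 r'.
  move=> r0 r'0 kk; rewrite /e.
  have -> : p2 - th + (q2 - th) = p1 - th + (q1 - th) by lra.
  rewrite mulrACA [ltRHS]mulrACA ltr_pM2r; last first.
    by rewrite mulr_gt0 ?powR_gt0 ?addr_gt0.
  by apply: beta_density_ratio_lt => //; lra.
have S0 : 0 < Gamma (p1 - th + (q1 - th)).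
  by apply: Gamma_gt0; rewrite addr_gt0 ?subr_gt0.
have Seq : p2 - th + (q2 - th) = p1 - th + (q1 - th) by lra.
have main : 0 < sg * (kernel_mass p1 q1 T *
     (2 * (Gamma (p2 - th) * Gamma (q2 - th)) / Gamma (p2 - th + (q2 - th))) -
   kernel_mass p2 q2 T *
     (2 * (Gamma (p1 - th) * Gamma (q1 - th)) / Gamma (p1 - th + (q1 - th)))).
  case: sg1 => sgE.
    rewrite sgE mul1r subr_gt0.
    apply: (@chebyshev_integral _ k (e p1 q1) (e p2 q2) W) => //; try exact: e0;
      try exact: ES; try exact: EA.
    move=> r r' r0 r'0 kk; rewrite nmulr_rlt0 ?subr_lt0 ?e_k //.
    by have := ltW_k _ _ r0 r'0 kk; rewrite sgE mul1r.
  rewrite sgE mulN1r opprB subr_gt0.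
  apply: (@chebyshev_integral _ k (e p2 q2) (e p1 q1) W) => //; try exact: e0;
    try exact: ES; try exact: EA.
  move=> r r' r0 r'0 kk; rewrite pmulr_rlt0 ?subr_gt0 ?e_k //.
  by have := ltW_k _ _ r0 r'0 kk; rewrite sgE mulN1r oppr_gt0.
have scale (g u1 u2 x1 x2 : R) : 0 < g ->
    0 < sg * (u1 * (2 * x1 / g) - u2 * (2 * x2 / g)) -> 0 < sg * (u1 * x1 - u2 * x2).
  move=> g0 h; have g2 : 0 < g / 2 by rewrite divr_gt0.
  rewrite (_ : _ * _ = g / 2 * (sg * (u1 * (2 * x1 / g) - u2 * (2 * x2 / g)))).
    exact: mulr_gt0.
  by field; exact: lt0r_neq0.
by move: main; rewrite Seq; exact: scale.
Qed.

End kernel_comparison.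

(** * The logistic weight and the constant theta0 *)

Section logistic.
Context {R : realType}.

Definition logistic (t : R) : R := (1 + expR (- t)) `^ (-1).

Lemma logisticE t : logistic t = (1 + expR (- t))^-1.
Proof. by rewrite /logistic powR_inv1 // addr_ge0 ?expR_ge0. Qed.

Lemma measurable_logistic : measurable_fun setT logistic.
Proof. by rewrite /logistic; measurability. Qed.

Lemma logistic_gt0 t : 0 < logistic t.
Proof. by rewrite powR_gt0 // addr_gt0 ?expR_gt0. Qed.

Lemma logistic_le1 t : logistic t <= 1.
Proof. by rewrite logisticE invf_le1 ?addr_gt0 ?expR_gt0 // lerDl expR_ge0. Qed.

Lemma dist_lt_of_mul (A B A' B' : R) : A + B = A' + B' -> A * B < A' * B' ->
  `|A' - B'| < `|A - B|.
Proof.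
move=> s p; rewrite -ltr_sqr ?nnegrE // !real_normK ?num_real //.
have -> : (A' - B') ^+ 2 = (A' + B') ^+ 2 - 4 * (A' * B') by ring.
have -> : (A - B) ^+ 2 = (A + B) ^+ 2 - 4 * (A * B) by ring.
by rewrite s; lra.
Qed.

(** With S = A + B, the reciprocal of the product is
    1 + e^-S + 2 e^(-S/2) cosh ((A - B) / 2). *)
Lemma logistic_mul_lt (A B A' B' : R) : A + B = A' + B' -> A * B < A' * B' ->
  logistic A * logistic B < logistic A' * logistic B'.
Proof.
move=> s p; have lt_dist := dist_lt_of_mul s p.
rewrite !logisticE -!invfM ltf_pV2 ?posrE ?mulr_gt0 ?addr_gt0 ?expR_gt0 //.
have E (x y : R) : (1 + expR (- x)) * (1 + expR (- y)) = 1 + expR (- (x + y)) +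
    expR (- ((x + y) / 2)) * (expR (`|x - y| / 2) + expR (- (`|x - y| / 2))).
  have -> : expR (`|x - y| / 2) + expR (- (`|x - y| / 2)) =
      expR ((x - y) / 2) + expR (- ((x - y) / 2)).
    case: (ger0P (x - y)) => _ //.
    by rewrite addrC !mulNr opprK.
  rewrite [X in _ = _ + X]mulrDr -!expRD.
  have -> : - ((x + y) / 2) + (x - y) / 2 = - y by field.
  have -> : - ((x + y) / 2) + - ((x - y) / 2) = - x by field.
  rewrite opprD expRD; move: (expR (- x)) (expR (- y)) => a b; ring.
rewrite !E s ltrD2l ltr_pM2l ?expR_gt0 //; apply: cosh_lt.
  have := normr_ge0 (A' - B'); lra.
by lra.
Qed.

Lemma split_weight_lt_ge0 (th : R) : 0 <= th ->
  forall A B A' B', 0 < A -> 0 < B -> 0 < A' -> 0 < B' ->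
  A + B = A' + B' -> A * B < A' * B' ->
  0 < 1 * (split_weight logistic th A' B' - split_weight logistic th A B).
Proof.
move=> th0 A B A' B' A0 B0 A'0 B'0 s p; rewrite mul1r subr_gt0 /split_weight.
apply: (@le_lt_trans _ _ ((A' * B') `^ th * (logistic A * logistic B))).
  rewrite ler_wpM2r ?mulr_ge0 ?(ltW (logistic_gt0 _)) //.
  by rewrite ge0_ler_powR ?nnegrE ?mulr_ge0 ?(ltW A0) ?(ltW B0) ?(ltW A'0) ?(ltW B'0) ?(ltW p).
by rewrite ltr_pM2l ?powR_gt0 ?mulr_gt0 // logistic_mul_lt.
Qed.

Lemma expR_tangent_lt (x y : R) : x != y -> expR y * (1 + (x - y)) < expR x.
Proof.
move=> xy; rewrite -[ltRHS](_ : expR y * expR (x - y) = _); last first.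
  by rewrite -expRD addrCA subrr addr0.
by rewrite ltr_pM2l ?expR_gt0 // expR_gt1Dx // subr_eq0.
Qed.

(** The equation of t0 reads h tanh h = 1 with h = t0 / 2. *)
Lemma t0_half : let h := t0 R / 2 in
  0 < h /\ expR h + expR (- h) = h * (expR h - expR (- h)).
Proof.
move=> h; have [t00 e] := t0P R; split; first by rewrite divr_gt0.
have tE : t0 R = h + h by rewrite /h; field.
move: e; rewrite tE expRD expRN => e.
have x0 : 0 < expR h := expR_gt0 h.
move: (expR h) x0 e => x x0 e; apply: (mulfI (lt0r_neq0 x0)).
rewrite mulrDr mulrCA mulrBr !mulfV ?lt0r_neq0 //; lra.
Qed.

(** With t = 2 h the left-hand side is the square of h / cosh h, and the tangent
    to cosh at h0 = t0 / 2 passes through the origin because h0 tanh h0 = 1;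
    strict convexity of cosh makes h0 the only maximum. *)
Lemma logistic_curvature_lt (t : R) : 0 < t -> t != t0 R ->
  t ^+ 2 * expR t / (expR t + 1) ^+ 2 < - theta0 R.
Proof.
move=> t_gt0 tt0; rewrite /theta0 opprK.
have [h0_gt0 eh0] := t0_half.
have K (s : R) : s ^+ 2 * expR s / (expR s + 1) ^+ 2 =
   (s / (expR (s / 2) + expR (- (s / 2)))) ^+ 2.
  have {2 3}-> : s = s / 2 + s / 2 by field.
  rewrite expRD expRN; have : 0 < expR (s / 2) := expR_gt0 _.
  move: (expR (s / 2)) => x x0; field; rewrite !lt0r_neq0 //.
    by rewrite addr_gt0 // mulr_gt0.
rewrite !K; set h := t / 2; set h0 := t0 R / 2.
have tE : t = 2 * h by rewrite /h; field.
have t0E : t0 R = 2 * h0 by rewrite /h0; field.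
have hh0 : h != h0 by apply: contra tt0 => /eqP e; rewrite tE t0E e.
have t0_gt0 : 0 < t0 R by have [] := t0P R.
have h_gt0 : 0 < h by rewrite divr_gt0.
have l1 := expR_tangent_lt hh0.
have l2 : expR (- h0) * (1 + (- h - - h0)) < expR (- h).
  by apply: expR_tangent_lt; rewrite eqr_opp.
rewrite -/h0 in eh0 h0_gt0; rewrite tE t0E.
clearbody h h0.
have p1 : 0 < expR h + expR (- h) by rewrite addr_gt0 ?expR_gt0.
have p2 : 0 < expR h0 + expR (- h0) by rewrite addr_gt0 ?expR_gt0.
move: (expR h) (expR (- h)) (expR h0) (expR (- h0)) eh0 l1 l2 p1 p2.
move=> x y u v eh0 l1 l2 p1 p2.
have M0 : 0 < u - v by rewrite -(pmulr_rgt0 _ h0_gt0) -eh0.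
(* x + y = 2 cosh h and u - v = 2 sinh h0 *)
have main : h * (u - v) < x + y.
  have -> : h * (u - v) = u * (1 + (h - h0)) + v * (1 + (- h - - h0)).
    have -> : u * (1 + (h - h0)) + v * (1 + (- h - - h0)) =
      (u + v) - h0 * (u - v) + h * (u - v) by ring.
    by rewrite eh0 subrr add0r.
  by rewrite ltrD.
rewrite ltr_pXn2r ?nnegrE ?divr_ge0 ?mulr_ge0 ?(ltW h_gt0) ?(ltW h0_gt0) ?(ltW p1) ?(ltW p2) //.
rewrite eh0 ltr_pdivrMr // mulrAC ltr_pdivlMr ?mulr_gt0 //.
have -> : 2 * h * (h0 * (u - v)) = 2 * h0 * (h * (u - v)) by ring.
by rewrite ltr_pM2l // mulr_gt0.
Qed.

Lemma logistic_curvature_le (t : R) : 0 < t ->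
  t ^+ 2 * expR t / (expR t + 1) ^+ 2 <= - theta0 R.
Proof.
move=> t0'; have [->|tt0] := eqVneq t (t0 R); last exact: ltW (logistic_curvature_lt _ _).
by rewrite /theta0 opprK.
Qed.

Lemma mean_value_half_line (f df : R -> R) (a b : R) :
  (forall x : R, 0 < x -> is_derive x 1 f (df x)) -> 0 < a -> a < b ->
  exists c, [/\ a < c, c < b & f b - f a = df c * (b - a)].
Proof.
move=> dF a0 ab.
have pos x : a <= x -> 0 < x by exact: lt_le_trans.
have [] := @MVT R f df a b ab.
- move=> x; rewrite in_itv /= => /andP[/ltW/pos x0 _]; exact: dF.
- apply: derivable_within_continuous => x; rewrite in_itv /= => /andP[/pos x0 _].
  by have [] := dF x x0.
by move=> c; rewrite in_itv /= => /andP[ac cb] e; exists c.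
Qed.

(** The derivative of ln (t^th * logistic t). *)
Definition dlog_weight (th t : R) : R := th / t + (expR t + 1)^-1.

Lemma is_derive_log_weight (th t : R) : 0 < t ->
  is_derive t 1 (fun x => th * ln x - ln (1 + expR (- x))) (dlog_weight th t).
Proof.
move=> t0; have e1 : 0 < 1 + expR (- t) by rewrite addr_gt0 ?expR_gt0.
have d1 := is_deriveZ th (is_derive1_ln t0).
have d2 : is_derive t 1 (fun x : R => - x) (-1) := is_deriveN (is_derive_id t 1).
have d3 := is_derive1_comp (is_derive_expR _) d2.
have d4 : is_derive t 1 (fun x : R => 1 + expR (- x)) _ :=
  is_deriveD (is_derive_cst (1 : R) t 1) d3.
have d5 := @is_derive1_comp R _ (fun x : R => 1 + expR (- x)) t _ _ (is_derive1_ln e1) d4.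
have d6 : is_derive t 1 (fun x => th * ln x - ln (1 + expR (- x))) _ :=
  is_deriveB d1 d5.
apply: (is_derive_eq d6); rewrite /dlog_weight /GRing.scale /=.
have : 0 < expR t := expR_gt0 t; rewrite expRN.
move: (expR t) => x x0; field; rewrite !lt0r_neq0 //.
by rewrite addr_gt0.
Qed.

(** The second logarithmic derivative in the form that displays the quantity
    bounded by [logistic_curvature_lt]. *)
Lemma is_derive_dlog_weight (th t : R) : 0 < t ->
  is_derive t 1 (dlog_weight th)
    (t ^- 2 * (- th - t ^+ 2 * expR t / (expR t + 1) ^+ 2)).
Proof.
move=> t0; have e1 : 0 < expR t + 1 by rewrite addr_gt0 ?expR_gt0.
have d1 : is_derive t 1 (fun x : R => th * x^-1) _ :=
  is_deriveZ th (is_deriveV (lt0r_neq0 t0) (is_derive_id t 1)).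
have d4 : is_derive t 1 (fun x : R => expR x + 1) _ :=
  is_deriveD (is_derive_expR t) (is_derive_cst (1 : R) t 1).
have d5 := @is_deriveV R (fun x : R => expR x + 1) t _ _ (lt0r_neq0 e1) d4.
have d6 : is_derive t 1 (dlog_weight th) _ := is_deriveD d1 d5.
apply: (is_derive_eq d6); rewrite /GRing.scale /=.
have : 0 < expR t := expR_gt0 t.
move: (expR t) e1 => x e1 x0; field; rewrite !lt0r_neq0 //.
Qed.

(** The slope is positive except possibly at t0.  Two mean values, on the two
    halves of [s, t], cannot both be t0, which gives strictness also for
    th = theta0. *)
Lemma dlog_weight_lt (th s t : R) : th <= theta0 R -> 0 < s -> s < t ->
  dlog_weight th s < dlog_weight th t.
Proof.
move=> hth s0 st; pose m := (s + t) / 2.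
have sm : s < m by rewrite /m; lra.
have mt : m < t by rewrite /m; lra.
have [c [sc cm ec]] := mean_value_half_line (@is_derive_dlog_weight th) s0 sm.
have [d [md dt ed]] := mean_value_half_line (@is_derive_dlog_weight th) (lt_trans s0 sm) mt.
have slope_ge0 x : 0 < x ->
    0 <= x ^- 2 * (- th - x ^+ 2 * expR x / (expR x + 1) ^+ 2).
  move=> x0; rewrite mulr_ge0 ?invr_ge0 ?sqr_ge0 // subr_ge0.
  by apply: le_trans (logistic_curvature_le x0) _; rewrite lerN2.
have slope_gt0 x : 0 < x -> x != t0 R ->
    0 < x ^- 2 * (- th - x ^+ 2 * expR x / (expR x + 1) ^+ 2).
  move=> x0 xt; rewrite mulr_gt0 ?invr_gt0 ?exprn_gt0 // subr_gt0.
  by apply: lt_le_trans (logistic_curvature_lt x0 xt) _; rewrite lerN2.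
have c0 := lt_trans s0 sc; have d0 : 0 < d by lra.
have ms0 : 0 < m - s by lra.
have tm0 : 0 < t - m by lra.
have [ct0|ct0] := eqVneq c (t0 R).
  have dt0 : d != t0 R by rewrite -ct0 gt_eqF // (lt_trans cm).
  have h1 := mulr_ge0 (slope_ge0 _ c0) (ltW ms0).
  have h2 := mulr_gt0 (slope_gt0 _ d0 dt0) tm0.
  rewrite -ec in h1; rewrite -ed in h2; lra.
have h1 := mulr_gt0 (slope_gt0 _ c0 ct0) ms0.
have h2 := mulr_ge0 (slope_ge0 _ d0) (ltW tm0).
rewrite -ec in h1; rewrite -ed in h2; lra.
Qed.

Lemma split_weightC (w : R -> R) (th A B : R) :
  split_weight w th A B = split_weight w th B A.
Proof. by rewrite /split_weight (mulrC A) (mulrC (w A)). Qed.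

Lemma split_weight_expR (th A B : R) : 0 < A -> 0 < B ->
  split_weight logistic th A B =
  expR ((th * ln A - ln (1 + expR (- A))) + (th * ln B - ln (1 + expR (- B)))).
Proof.
move=> A0 B0; rewrite /split_weight powRM ?ltW //.
have E (x : R) : 0 < x -> expR (th * ln x - ln (1 + expR (- x))) = x `^ th * logistic x.
  move=> x0; rewrite expRD expRN lnK ?posrE ?addr_gt0 ?expR_gt0 //.
  by rewrite logisticE /powR gt_eqF.
by rewrite expRD !E // mulrACA.
Qed.

(** Strict convexity of ln (t^th * logistic t): for A < A' <= B' < B with
    A' - A = B - B', the mean value theorem compares the two increments. *)
Lemma split_weight_lt_le_theta0 (th : R) : th <= theta0 R ->
  forall A B A' B', 0 < A -> 0 < B -> 0 < A' -> 0 < B' ->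
  A + B = A' + B' -> A * B < A' * B' ->
  0 < -1 * (split_weight logistic th A' B' - split_weight logistic th A B).
Proof.
move=> hth; suff main (A B A' B' : R) : 0 < A -> 0 < B -> 0 < A' -> 0 < B' ->
    A <= B -> A' <= B' -> A + B = A' + B' -> A * B < A' * B' ->
    split_weight logistic th A' B' < split_weight logistic th A B.
  move=> A B A' B' A0 B0 A'0 B'0 s p; rewrite mulN1r opprB subr_gt0.
  case: (lerP A B) => AB; case: (lerP A' B') => AB'.
  - exact: main.
  - rewrite split_weightC; apply: main => //; first exact: ltW.
      by rewrite s addrC.
    by rewrite (mulrC B').
  - rewrite [ltRHS]split_weightC; apply: main => //; first exact: ltW.
      by rewrite addrC.
    by rewrite (mulrC B).
  - rewrite split_weightC [ltRHS]split_weightC; apply: main => //; try exact: ltW.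
      by rewrite addrC s addrC.
    by rewrite (mulrC B) (mulrC B').
move=> A0 B0 A'0 B'0 AB AB' s p.
have := dist_lt_of_mul s p; rewrite distrC (distrC A) !ger0_norm ?subr_ge0 // => dist.
rewrite !split_weight_expR // ltr_expR.
have AA' : A < A' by lra.
have BB' : B' < B by lra.
have [c [c1 c2 ec]] := mean_value_half_line (@is_derive_log_weight th) A0 AA'.
have [d [d1 d2 ed]] := mean_value_half_line (@is_derive_log_weight th) B'0 BB'.
have cd : c < d by lra.
have := dlog_weight_lt hth (lt_trans A0 c1) cd.
have e : A' - A = B - B' by lra.
rewrite -(@ltr_pM2r _ (A' - A)) ?subr_gt0 // -ec e -ed; lra.
Qed.

End logistic.

(** * Two-factor comparison of normalised transforms *)

Section dominance.
Context {R : realType}.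
Local Notation mu := (@lebesgue_measure R).
Local Notation D := (`]0%R, +oo[%classic : set R).

(** The difference is the Laplace transform of the positive function f - g. *)
Lemma laplace_lt (f g : R -> R) : laplace_dom f -> measurable_fun D g ->
  (forall t, 0 < t -> 0 <= g t) -> (forall t, 0 < t -> g t < f t) ->
  cm (fun x => laplace f x - laplace g x) /\
    forall x : R, 0 < x -> 0 < laplace f x - laplace g x.
Proof.
move=> df mg g0 gf; have [mf f0 fy] := df.
have me x : measurable_fun D (fun t : R => expR (- (x * t))) by exact: measurable_expRM.
have sub (h : R -> R) : measurable_fun D h -> (forall t, 0 < t -> 0 <= h t) ->
    (forall t, 0 < t -> h t <= f t) -> laplace_dom h.
  move=> mh h0 hf; split => // x x0; apply: le_lt_trans (fy x x0).
  apply: ge0_le_integral => //.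
  - by move=> t /half_lineP t0; rewrite lee_fin mulr_ge0 ?expR_ge0 ?h0.
  - by apply/measurable_EFinP; apply: measurable_funM => //; exact: me.
  - by apply/measurable_EFinP; apply: measurable_funM => //; exact: me.
  - by move=> t /half_lineP t0; rewrite lee_fin ler_wpM2r ?expR_ge0 ?hf.
have dg : laplace_dom g by apply: sub => // t t0; apply: ltW; exact: gf.
have d : laplace_dom (fun t => f t - g t).
  apply: sub; first exact: measurable_funB.
    by move=> t t0; rewrite subr_ge0; apply: ltW; exact: gf.
  by move=> t t0; rewrite gerBl; exact: g0.
have E x : 0 < x -> laplace (fun t => f t - g t) x = laplace f x - laplace g x.
  move=> x0; rewrite /laplace -RintegralB //; [|exact: laplace_integrable..].
  by apply: eq_Rintegral => t _; rewrite mulrBl.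
split; first exact: eq_cm E (cm_laplace d).
move=> x x0; rewrite -E // -lte_fin -laplaceE //.
apply: (@integral_gt0 _ _ 0 1) => //.
- by apply/measurable_EFinP; apply: measurable_funM => //; exact: measurable_funB.
- by move=> t t0; rewrite lee_fin mulr_ge0 ?expR_ge0 // subr_ge0; apply: ltW; exact: gf.
- by move=> t t0 _; rewrite lte_fin mulr_gt0 ?expR_gt0 // subr_gt0 gf.
Qed.

Definition alt_mellin (p : R) : R -> R := laplace (mellin_weight logistic p).

Lemma alt_mellin_dom p : 0 < p -> laplace_dom (mellin_weight (@logistic R) p).
Proof.
apply: laplace_dom_mellin_weight; [exact: measurable_logistic|..];
  by move=> t _; rewrite ?logistic_gt0 ?logistic_le1.
Qed.

Lemma alt_mellin_gt0 p x : 0 < p -> 0 < x -> 0 < alt_mellin p x.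
Proof.
move=> p0 x0; rewrite -lte_fin -(laplaceE (alt_mellin_dom p0) x0).
have [mf _ _] := alt_mellin_dom p0.
have pos t : 0 < t -> 0 < mellin_weight logistic p t * expR (- (x * t)).
  by move=> t0; rewrite mulr_gt0 ?expR_gt0 // mulr_gt0 ?powR_gt0 ?logistic_gt0.
apply: (@integral_gt0 _ _ 0 1) => //.
- by apply/measurable_EFinP; apply: measurable_funM => //; exact: measurable_expRM.
- by move=> t t0; rewrite lee_fin ltW ?pos.
- by move=> t t0 _; rewrite lte_fin pos.
Qed.

(** The function whose Laplace transform is the product of two normalised
    transforms. *)
Definition pair_density (th p q T : R) : R :=
  T `^ (p + q - 1) * (kernel_mass logistic p q T / (2 * (Gamma (p - th) * Gamma (q - th)))).

Definition normalized_mellin (th p x : R) : R := alt_mellin p x / Gamma (p - th).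

Lemma pair_density_laplace th p q : 0 < p -> 0 < q -> th < p -> th < q ->
  laplace_dom (pair_density th p q) /\
  forall x, 0 < x -> laplace (pair_density th p q) x =
    normalized_mellin th p x * normalized_mellin th q x.
Proof.
move=> p0 q0 tp tq.
have Gp : 0 < Gamma (p - th) by rewrite Gamma_gt0 ?subr_gt0.
have Gq : 0 < Gamma (q - th) by rewrite Gamma_gt0 ?subr_gt0.
have l0 t : 0 < t -> 0 < @logistic R t by move=> _; exact: logistic_gt0.
have l1 t : 0 < t -> @logistic R t <= 1 by move=> _; exact: logistic_le1.
have ml := @measurable_logistic R.
set c := (2 * (Gamma (p - th) * Gamma (q - th)))^-1.
have c0 : 0 < c by rewrite invr_gt0 (pmulr_rgt0 _ (ltr0Sn _ 1)) (mulr_gt0 Gp Gq).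
have mm := measurable_kernel_mass ml l0 p q.
have m0 T : 0 < T -> 0 < kernel_mass logistic p q T by exact: kernel_mass_gt0.
have mF x : measurable_fun D (fun T : R =>
    T `^ (p + q - 1) * expR (- (x * T)) * kernel_mass logistic p q T).
  by apply: measurable_funM => //; apply: measurable_funTS; exact: measurable_powR_mul_expR.
have main x : 0 < x -> (\int[mu]_(T in D) (pair_density th p q T * expR (- (x * T)))%:E =
    (normalized_mellin th p x * normalized_mellin th q x)%:E)%E.
  move=> x0.
  have -> : normalized_mellin th p x * normalized_mellin th q x =
      c * (2 * (alt_mellin p x * alt_mellin q x)).
    rewrite /normalized_mellin /c.
    move: (Gamma (p - th)) Gp => a a0.
    move: (Gamma (q - th)) Gq => b b0.
 move: (alt_mellin p x) => u. move: (alt_mellin q x) => v.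
   field.
    by rewrite !lt0r_neq0.
  rewrite EFinM (laplace_product_sym ml l0 l1 p0 q0 x0).
  rewrite [X in _ = (_ * X)%E](_ : _ = (\int[mu]_(T in D)
     (T `^ (p + q - 1) * expR (- (x * T)) * kernel_mass logistic p q T)%:E)%E); last first.
    apply: eq_integral => T; rewrite inE => /half_lineP T0.
    by rewrite (kernel_massE ml l0 l1 p0 q0 T0) -EFinM.
  rewrite -ge0_integralZl_EFin ?(ltW c0) //.
  - by apply: eq_integral => T _; rewrite /pair_density -/c -EFinM; congr (_%:E); ring.
  - move=> T /half_lineP T0; rewrite lee_fin mulr_ge0 ?(ltW (m0 _ T0)) //.
    by rewrite mulr_ge0 ?powR_ge0 ?expR_ge0.
  - by apply/measurable_EFinP; exact: mF.
have d : laplace_dom (pair_density th p q).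
  split.
  - apply: measurable_funM; first by apply: measurable_funTS; measurability.
    by apply: measurable_funM.
  - move=> T T0; rewrite mulr_ge0 ?powR_ge0 // mulr_ge0 ?(ltW (m0 _ T0)) //.
    exact: ltW.
  - by move=> x x0; rewrite main // ltry.
by split => // x x0; apply: EFin_inj; rewrite -laplaceE // main.
Qed.

Variables (th sg : R).
Hypothesis sg1 : sg = 1 \/ sg = -1.
Hypothesis split_weight_lt : forall A B A' B', 0 < A -> 0 < B -> 0 < A' -> 0 < B' ->
  A + B = A' + B' -> A * B < A' * B' ->
  0 < sg * (split_weight logistic th A' B' - split_weight logistic th A B).

(** The sign sg treats the two ranges of th at once.  Positivity is recorded
    apart, since complete monotonicity by itself only gives nonnegativity. *)
Definition dominates (f g : R -> R) : Prop :=
  cm (fun x => sg * (f x - g x)) /\ forall x : R, 0 < x -> 0 < sg * (f x - g x).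

Lemma dominates_trans f g h : dominates f g -> dominates g h -> dominates f h.
Proof.
move=> [c1 l1] [c2 l2]; split.
  by apply: eq_cm (cmD c1 c2) => x x0; ring.
move=> x x0; rewrite (_ : _ * _ = sg * (f x - g x) + sg * (g x - h x)); last by ring.
by rewrite addr_gt0 ?l1 ?l2.
Qed.

Lemma normalized_mellin_gt0 p x : 0 < p -> th < p -> 0 < x -> 0 < normalized_mellin th p x.
Proof. by move=> p0 tp x0; rewrite divr_gt0 ?alt_mellin_gt0 ?Gamma_gt0 ?subr_gt0. Qed.

Lemma cm_normalized_mellin p : 0 < p -> th < p -> cm (normalized_mellin th p).
Proof.
move=> p0 tp; apply: cmM; first exact: cm_laplace (alt_mellin_dom p0).
by apply: cm_cst; rewrite invr_ge0 ltW // Gamma_gt0 ?subr_gt0.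
Qed.

Lemma dominates_mul p f g : 0 < p -> th < p -> dominates f g ->
  dominates (fun x => normalized_mellin th p x * f x)
            (fun x => normalized_mellin th p x * g x).
Proof.
move=> p0 tp [c l]; split.
  by apply: eq_cm (cmM (cm_normalized_mellin p0 tp) c) => x x0; ring.
move=> x x0; rewrite (_ : _ * _ = normalized_mellin th p x * (sg * (f x - g x))); last by ring.
by rewrite mulr_gt0 ?normalized_mellin_gt0 ?l.
Qed.

(** Both products are Laplace transforms of densities that [kernel_mass_lt]
    orders strictly, (c, d) being the more spread out pair. *)
Lemma dominates_pair a b c d : 0 < a -> 0 < b -> 0 < c -> 0 < d ->
  th < a -> th < b -> th < c -> th < d -> a + b = c + d -> d < a -> a < c ->
  dominates (fun x => normalized_mellin th a x * normalized_mellin th b x)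
            (fun x => normalized_mellin th c x * normalized_mellin th d x).
Proof.
wlog ba : a b / b <= a => [hw|] a0 b0 c0 d0 ta tb tc td s da ac.
  case: (lerP b a) => ba; first exact: hw.
  have [cc ll] : dominates
      (fun x => normalized_mellin th b x * normalized_mellin th a x)
      (fun x => normalized_mellin th c x * normalized_mellin th d x).
    by apply: hw => //; lra.
  split; first by apply: eq_cm cc => x _; rewrite [X in _ * (X - _)]mulrC.
  by move=> x x0; rewrite [X in _ * (X - _)]mulrC; exact: ll.
have [d1 e1] := pair_density_laplace a0 b0 ta tb.
have [d2 e2] := pair_density_laplace c0 d0 tc td.
have l0 t : 0 < t -> 0 < @logistic R t by move=> _; exact: logistic_gt0.
have l1 t : 0 < t -> @logistic R t <= 1 by move=> _; exact: logistic_le1.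
have [m1 p1 _] := d1; have [m2 p2 _] := d2.
have lt T : 0 < T -> 0 < sg * (pair_density th a b T - pair_density th c d T).
  move=> T0.
  have : 0 < sg * (kernel_mass logistic a b T * (Gamma (c - th) * Gamma (d - th)) -
            kernel_mass logistic c d T * (Gamma (a - th) * Gamma (b - th))).
    by apply: (kernel_mass_lt (@measurable_logistic R) l0 l1 sg1 split_weight_lt) => //; lra.
  rewrite /pair_density s.
  have Ga : 0 < Gamma (a - th) by rewrite Gamma_gt0 ?subr_gt0.
  have Gb : 0 < Gamma (b - th) by rewrite Gamma_gt0 ?subr_gt0.
  have Gc : 0 < Gamma (c - th) by rewrite Gamma_gt0 ?subr_gt0.
  have Gd : 0 < Gamma (d - th) by rewrite Gamma_gt0 ?subr_gt0.
  have : 0 < T `^ (c + d - 1) by rewrite powR_gt0.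
  move: (T `^ _) => v.
  move: (kernel_mass logistic a b T) => k1; move: (kernel_mass logistic c d T) => k2.
  move: (Gamma (a - th)) Ga => x x0; move: (Gamma (b - th)) Gb => y y0.
  move: (Gamma (c - th)) Gc => z z0; move: (Gamma (d - th)) Gd => u u0.
  move=> v0 h.
  rewrite (_ : _ * _ = v / (2 * (x * y * (z * u))) * (sg * (k1 * (z * u) - k2 * (x * y)))).
    by apply: mulr_gt0 => //; apply: divr_gt0 => //; rewrite !mulr_gt0.
  by field; rewrite !lt0r_neq0.
case: sg1 => sgE; rewrite /dominates sgE.
  have lt' T : 0 < T -> pair_density th c d T < pair_density th a b T.
    by move=> T0; have := lt T T0; rewrite sgE mul1r subr_gt0.
  have [cc ll] := laplace_lt d1 m2 p2 lt'; split.
    by apply: eq_cm cc => x x0; rewrite (e1 x x0) (e2 x x0) mul1r.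
  by move=> x x0; rewrite mul1r -(e1 x x0) -(e2 x x0); exact: ll.
have lt' T : 0 < T -> pair_density th a b T < pair_density th c d T.
  by move=> T0; have := lt T T0; rewrite sgE mulN1r opprB subr_gt0.
have [cc ll] := laplace_lt d2 m1 p1 lt'; split.
  by apply: eq_cm cc => x x0; rewrite (e1 x x0) (e2 x x0) mulN1r opprB.
by move=> x x0; rewrite mulN1r opprB -(e1 x x0) -(e2 x x0); exact: ll.
Qed.

End dominance.

(** * From two factors to majorization *)

Section majorization.
Context {R : realType}.
(** The passage from two factors to many only uses that the comparison is
    transitive and stable under multiplication by a factor. *)
Variables (phi : R -> R -> R) (m : R) (dom : (R -> R) -> (R -> R) -> Prop).

Definition prodf (s : seq R) (x : R) : R := \prod_(a <- s) phi a x.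

Hypothesis dom_trans : forall f g h, dom f g -> dom g h -> dom f h.
Hypothesis dom_mul : forall a f g, m < a -> dom f g ->
  dom (fun x => phi a x * f x) (fun x => phi a x * g x).
Hypothesis dom_pair : forall a b c d, m < a -> m < b -> m < c -> m < d ->
  a + b = c + d -> d < a -> a < c ->
  dom (fun x => phi a x * phi b x) (fun x => phi c x * phi d x).

Lemma prodf_cons a s : prodf (a :: s) = (fun x => phi a x * prodf s x).
Proof. by apply/funext => x; rewrite /prodf big_cons. Qed.

Lemma perm_prodf s t : perm_eq s t -> prodf s = prodf t.
Proof. by move=> st; apply/funext => x; exact: perm_big. Qed.

Lemma dom_prodf_cat s t u : all (fun a => m < a) u ->
  dom (prodf s) (prodf t) -> dom (prodf (u ++ s)) (prodf (u ++ t)).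
Proof.
elim: u => [//|a u IH] /= /andP[ma mu] st.
by rewrite !prodf_cons; apply: dom_mul => //; exact: IH.
Qed.

(** Strict comparisons fail exactly for rearrangements, so the two cases are
    kept apart. *)
Definition perm_or_dom (p q : seq R) : Prop := perm_eq p q \/ dom (prodf p) (prodf q).

Lemma perm_or_dom_trans p q r : perm_or_dom p q -> perm_or_dom q r -> perm_or_dom p r.
Proof.
move=> [pq|pq] [qr|qr].
- by left; exact: perm_trans qr.
- by right; rewrite (perm_prodf pq).
- by right; rewrite -(perm_prodf qr).
- by right; exact: dom_trans qr.
Qed.

Lemma perm_or_dom_pair a b c d s : m < a -> m < b -> m < c -> m < d ->
  all (fun x => m < x) s -> a + b = c + d -> d <= a -> a <= c ->
  perm_or_dom (a :: b :: s) (c :: d :: s).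
Proof.
move=> ma mb mc md ms e.
rewrite le_eqVlt => /predU1P[da|da]; last rewrite le_eqVlt => /predU1P[ac|ac].
- move=> _; left; have -> : b = c by lra.
  rewrite da.
  by rewrite -[a :: c :: s]/([:: a] ++ [:: c] ++ s)
    -[c :: a :: s]/([:: c] ++ [:: a] ++ s) perm_catCA.
- left; have -> : b = d by lra.
  by rewrite ac.
right; have P (x y : R) : prodf [:: x; y] = (fun z => phi x z * phi y z).
  by apply/funext => z; rewrite /prodf !big_cons big_nil mulr1.
have C x y : perm_eq (x :: y :: s) (s ++ [:: x; y]).
  by rewrite -[x :: _]/([:: x; y] ++ s) perm_catC.
rewrite (perm_prodf (C a b)) (perm_prodf (C c d)); apply: dom_prodf_cat => //.
by rewrite !P; exact: dom_pair.
Qed.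

Lemma mulrn_le_sum_take (u : seq R) (c : R) k : all (fun a => c < a) u -> (k <= size u)%N ->
  c *+ k <= \sum_(a <- take k u) a.
Proof.
elim: u k => [|a u IH] [|k] //=; rewrite ?big_nil ?mulr0n //.
move=> /andP[ca cu] ku; rewrite big_cons mulrS lerD ?IH //; exact: ltW.
Qed.

Lemma sum_take_le_mulrn (u : seq R) (c : R) k : all (fun a => a <= c) u -> (k <= size u)%N ->
  \sum_(a <- take k u) a <= c *+ k.
Proof.
elim: u k => [|a u IH] [|k] //=; rewrite ?big_nil ?mulr0n //.
by move=> /andP[ca cu] ku; rewrite big_cons mulrS lerD ?IH.
Qed.

Lemma mulrn_lt_sum (u : seq R) (c : R) : all (fun a => c < a) u -> (0 < size u)%N ->
  c *+ size u < \sum_(a <- u) a.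
Proof.
case: u => [|a u] //= /andP[ca cu] _; rewrite big_cons mulrS ltr_leD //.
by have := mulrn_le_sum_take cu (leqnn _); rewrite take_size.
Qed.

(** The induction allows q in any order, because the entry q1 + b - p1 that is
    put back into q need not respect an order; the prefix sums of q keep
    dominating those of p. *)
Lemma majorized_dom n : forall p q : seq R, size p = n -> size q = n ->
  sorted >=%R p -> all (fun a => m < a) p -> all (fun a => m < a) q ->
  (forall k, (k <= n)%N -> \sum_(a <- take k p) a <= \sum_(a <- take k q) a) ->
  \sum_(a <- p) a = \sum_(a <- q) a -> perm_or_dom p q.
Proof.
elim: n => [|n IH] [|p1 p] [|q1 q] //=; first by move=> *; left.
move=> [sp] [sq] path_p /andP[mp1 mp] /andP[mq1 mq] pre tot.
have le_p : all (fun a => a <= p1) p.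
  by apply/allP => a ap; move/(order_path_min (rev_trans le_trans))/allP : path_p; apply.
have pq1 : p1 <= q1 by have := pre 1%N isT; rewrite /= !take0 !big_seq1.
rewrite !big_cons in tot.
have [n0|n0] := posnP n.
  left; move: sp sq; rewrite n0 => /size0nil p0 /size0nil q0.
  by move: tot; rewrite p0 q0 !big_nil !addr0 => ->.
(* otherwise the sum of q would exceed that of p *)
have has_b : has (fun b => b <= p1) q.
  apply: contraT; rewrite -all_predC => /= allq.
  have allq' : all (fun a => p1 < a) q by apply: sub_all allq => a /=; rewrite -ltNge.
  have h1 := sum_take_le_mulrn le_p (leqnn _); rewrite take_size sp in h1.
  have : p1 *+ n < \sum_(a <- q) a.
    by rewrite -sq; apply: mulrn_lt_sum; rewrite ?sq.
  by lra.
(* b is the first entry that is at most p1; the entries u before it exceed p1,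
   which gives the prefix inequalities inside u *)
have [b [u [v [qE bp u_gt]]]] : exists b u v,
    [/\ q = u ++ b :: v, b <= p1 & all (fun a => p1 < a) u].
  exists (nth 0 q (find (fun b => b <= p1) q)), (take (find (fun b => b <= p1) q) q),
    (drop (find (fun b => b <= p1) q).+1 q); split.
  - by rewrite -drop_nth -?has_find // cat_take_drop.
  - exact: (nth_find 0 has_b).
  - apply/(all_nthP 0) => i; rewrite size_take -has_find has_b => hi.
    by rewrite nth_take // ltNge (before_find 0 hi).
set c := q1 + b - p1.
have mb : m < b by move: mq; rewrite qE all_cat /= => /and3P[].
have mu : all (fun a => m < a) u by move: mq; rewrite qE all_cat /= => /and3P[].
have mv : all (fun a => m < a) v by move: mq; rewrite qE all_cat /= => /and3P[].
have mc : m < c by rewrite /c; lra.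
have sz_q' : size (u ++ c :: v) = n by rewrite -sq qE !size_cat.
have IHq : perm_or_dom p (u ++ c :: v).
  apply: IH => //.
  - exact: path_sorted path_p.
  - by rewrite all_cat /= mu mc mv.
  - move=> k kn; case: (leqP k (size u)) => ku.
      rewrite takel_cat //; apply: le_trans (mulrn_le_sum_take u_gt ku).
      by apply: sum_take_le_mulrn; rewrite ?sp.
    have := pre k.+1 kn; rewrite /= !big_cons qE !take_cat ltnNge (ltnW ku) /=.
    case: (k - size u)%N (subn_gt0 (size u) k) => [|j]; first by rewrite ku.
    by rewrite /= !big_cat !big_cons /= /c; lra.
  - by move: tot; rewrite qE !big_cat !big_cons /= /c; lra.
apply: (@perm_or_dom_trans _ (p1 :: u ++ c :: v)).
  case: IHq => [h|h]; first by left; rewrite perm_cons.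
  by right; rewrite !prodf_cons; exact: dom_mul.
have perm_out x y : perm_eq (x :: u ++ y :: v) (x :: y :: (u ++ v)).
  by rewrite perm_cons perm_sym -cat1s perm_catCA.
apply: (@perm_or_dom_trans _ (p1 :: c :: (u ++ v))); first by left.
apply: (@perm_or_dom_trans _ (q1 :: b :: (u ++ v))); last first.
  by left; rewrite qE perm_sym.
apply: perm_or_dom_pair => //; first by rewrite all_cat mu.
by rewrite /c; lra.
Qed.

End majorization.

(** * The alternating Hurwitz zeta function as a Laplace transform *)

Section zeta.
Context {R : realType}.
Local Notation mu := (@lebesgue_measure R).
Local Notation D := (`]0%R, +oo[%classic : set R).

(** The logistic weight cancels: logistic t * (1 + e^-t) = 1. *)
Lemma alt_mellin_shift (p y : R) : 0 < p -> 0 < y ->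
  alt_mellin p y + alt_mellin p (y + 1) = y `^ (- p) * Gamma p.
Proof.
move=> p0 y0; have y1 : 0 < y + 1 by rewrite addr_gt0.
have dp := alt_mellin_dom p0; have [mf f0 _] := dp.
apply: EFin_inj; rewrite EFinD -(Gamma_integral p0 y0).
rewrite -(laplaceE dp y0) -(laplaceE dp y1) -ge0_integralD //.
- apply: eq_integral => t _; rewrite -EFinD; congr (_%:E).
  have e1 : expR (- ((y + 1) * t)) = expR (- (y * t)) * expR (- t).
    by rewrite -expRD; congr expR; ring.
  rewrite e1 /mellin_weight logisticE.
  have : 0 < 1 + expR (- t) by rewrite addr_gt0 ?expR_gt0.
  by move: (expR _) (expR _) (_ `^ _) => a b c b0; field; exact: lt0r_neq0.
- by move=> t /half_lineP t0; rewrite lee_fin mulr_ge0 ?expR_ge0 ?f0.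
- by apply/measurable_EFinP; apply: measurable_funM => //; exact: measurable_expRM.
- by move=> t /half_lineP t0; rewrite lee_fin mulr_ge0 ?expR_ge0 ?f0.
- by apply/measurable_EFinP; apply: measurable_funM => //; exact: measurable_expRM.
Qed.

Lemma alt_mellin_le (p y : R) : 0 < p -> 0 < y -> alt_mellin p y <= y `^ (- p) * Gamma p.
Proof.
move=> p0 y0; rewrite -alt_mellin_shift // lerDl ltW // alt_mellin_gt0 //.
by rewrite addr_gt0.
Qed.

Lemma alt_mellin_cvg0 (p x : R) : 0 < p -> 0 < x ->
  (fun n : nat => alt_mellin p (n%:R + x)) @ \oo --> (0 : R).
Proof.
move=> p0 x0; have G0 := Gamma_gt0 p0.
apply/cvgrPdist_lt => e e0; near=> n.
have nx : 0 < n%:R + x by rewrite ltr_wpDl.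
rewrite sub0r normrN gtr0_norm ?alt_mellin_gt0 //.
apply: le_lt_trans (alt_mellin_le p0 nx) _.
rewrite -ltr_pdivlMr // powRN invf_plt ?posrE ?powR_gt0 ?divr_gt0 // invf_div.
have q0 : 0 <= Gamma p / e by rewrite divr_ge0 ?ltW.
rewrite [ltLHS](_ : _ = ((Gamma p / e) `^ p^-1) `^ p); last first.
  by rewrite -powRrM mulVf ?lt0r_neq0 // powRr1.
rewrite gt0_ltr_powR ?nnegrE ?powR_ge0 ?(ltW nx) //.
apply: (@le_lt_trans _ _ n%:R); last by rewrite ltrDl.
by near: n; exact: nbhs_infty_ger.
Unshelve. all: by end_near. Qed.

(** By [alt_mellin_shift] the partial sums telescope:
    Gamma(p) * (sum of the first n terms) = F(x) - (-1)^n F(x + n), and F tends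
    to 0 at infinity. *)
Lemma alt_hurwitz_zetaE (p x : R) : 0 < p -> 0 < x ->
  alt_hurwitz_zeta p x = alt_mellin p x / Gamma p.
Proof.
move=> p0 x0; have G0 := Gamma_gt0 p0.
rewrite /alt_hurwitz_zeta; apply: cvg_lim => //.
have -> : series (fun k : nat => (-1) ^+ k / (k%:R + x) `^ p) =
    (fun n : nat => (alt_mellin p x - (-1) ^+ n * alt_mellin p (n%:R + x)) / Gamma p).
  apply/funext; elim=> [|n IH].
    by rewrite /series /= big_nil expr0 mul1r add0r subrr mul0r.
  have nx : 0 < n%:R + x by rewrite ltr_wpDl.
  rewrite seriesSr IH -powRN exprS.
  have -> : n.+1%:R + x = n%:R + x + 1 by rewrite -natr1 addrAC.
  have -> : (n%:R + x) `^ (- p) =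
      (alt_mellin p (n%:R + x) + alt_mellin p (n%:R + x + 1)) / Gamma p.
    by rewrite alt_mellin_shift // mulfK ?lt0r_neq0.
  move: (Gamma p) G0 => g g0.
  move: (alt_mellin p x) (alt_mellin p (n%:R + x)) (alt_mellin p (n%:R + x + 1)).
  by move: ((-1) ^+ n) => s a b c; field; exact: lt0r_neq0.
have {2}-> : alt_mellin p x = alt_mellin p x - 0 by rewrite subr0.
apply: cvgM; last exact: cvg_cst.
apply: cvgB; first exact: cvg_cst.
apply: norm_cvg0; have := alt_mellin_cvg0 p0 x0.
apply: cvg_trans; apply: near_eq_cvg; near=> n.
rewrite normrM normrX normrN1 expr1n mul1r gtr0_norm // alt_mellin_gt0 //.
by rewrite ltr_wpDl.
Unshelve. all: by end_near. Qed.

Lemma alt_hurwitz_zeta_gt0 (p x : R) : 0 < p -> 0 < x -> 0 < alt_hurwitz_zeta p x.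
Proof. by move=> p0 x0; rewrite alt_hurwitz_zetaE // divr_gt0 ?alt_mellin_gt0 ?Gamma_gt0. Qed.

(** From F(x) = Gamma(p) x^-p - F(x + 1) with 0 <= F(x + 1) <= Gamma(p); the
    bounds show that x^p zeta*(p,x) tends to 1 at 0. *)
Lemma alt_hurwitz_zeta_bounds (p x : R) : 0 < p -> 0 < x ->
  x `^ (- p) * (1 - x `^ p) <= alt_hurwitz_zeta p x <= x `^ (- p).
Proof.
move=> p0 x0; have G0 := Gamma_gt0 p0; rewrite alt_hurwitz_zetaE //.
rewrite ler_pdivlMr // ler_pdivrMr // alt_mellin_le // andbT.
have -> : x `^ (- p) * (1 - x `^ p) = x `^ (- p) - 1.
  by rewrite mulrBr mulr1 -powRD ?(gt_eqF x0) ?implybT // addNr powRr0.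
have x1 : 0 < x + 1 by rewrite addr_gt0.
rewrite mulrBl -(alt_mellin_shift p0 x0) mul1r.
rewrite lerBlDr lerD2l.
apply: le_trans (alt_mellin_le p0 x1) _.
rewrite ler_piMl ?(ltW G0) // powRN invf_le1 ?powR_gt0 //.
by rewrite -[leLHS](powRr0 (x + 1)) ler_powR ?(ltW p0) // lerDr ltW.
Qed.

End zeta.

(** * The comparison for vectors *)

Section assembly.
Context {R : realType} (n : nat).
Implicit Types p q : 'rV[R]_n.+1.

Definition row_seq p : seq R := [seq p 0 j | j <- enum 'I_n.+1].

Lemma size_row_seq p : size (row_seq p) = n.+1.
Proof. by rewrite size_map size_enum_ord. Qed.

Lemma nth_row_seq p (j : 'I_n.+1) : (row_seq p)`_j = p 0 j.
Proof. by rewrite (nth_map ord0) ?size_enum_ord // nth_ord_enum. Qed.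

Lemma all_row_seq (P : pred R) p : (forall j, P (p 0 j)) -> all P (row_seq p).
Proof. by move=> Pp; apply/allP => a /mapP[j _ ->]. Qed.

Lemma sum_take_row_seq k p : (k <= n.+1)%N ->
  \sum_(a <- take k (row_seq p)) a = \sum_(j < n.+1 | (j < k)%N) p 0 j.
Proof.
move=> kn; rewrite (big_nth 0) size_takel ?size_row_seq // big_mkord.
rewrite (big_ord_widen _ (fun i => (take k (row_seq p))`_i) kn).
by apply: eq_bigr => j jk; rewrite nth_take // nth_row_seq.
Qed.

Lemma sum_row_seq p : \sum_(a <- row_seq p) a = \sum_(j < n.+1) p 0 j.
Proof. by rewrite big_map big_enum. Qed.

Lemma sorted_row_seq p : (forall i j : 'I_n.+1, (i <= j)%N -> p 0 j <= p 0 i) ->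
  sorted >=%R (row_seq p).
Proof.
move=> mono; apply/(sortedP 0) => i; rewrite size_row_seq => hi.
by have := mono (Ordinal (ltnW hi)) (Ordinal hi) (leqnSn i); rewrite -!nth_row_seq.
Qed.

Lemma row_seq_inj : injective row_seq.
Proof.
move=> p q pq; apply/rowP => j.
by rewrite -!nth_row_seq pq.
Qed.

Lemma prodf_row_seq (phi : R -> R -> R) p x :
  prodf phi (row_seq p) x = \prod_(j < n.+1) phi (p 0 j) x.
Proof. by rewrite /prodf big_map big_enum. Qed.

Variables (p q : 'rV[R]_n.+1).
Hypothesis hp : forall j, 0 < p 0 j.
Hypothesis hq : forall j, 0 < q 0 j.
Hypothesis hpq : majorized p q.

Lemma min_last_lt (th : R) : th < Num.min (p 0 ord_max) (q 0 ord_max) ->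
  (forall j, th < p 0 j) /\ (forall j, th < q 0 j).
Proof.
case: hpq => _ sq sp _ _; rewrite lt_min => /andP[tp tq].
by split => j; [apply: lt_le_trans tp _; apply: sp|apply: lt_le_trans tq _; apply: sq];
  rewrite -ltnS.
Qed.

Lemma dominates_row (th sg : R) : sg = 1 \/ sg = -1 ->
  (forall A B A' B', 0 < A -> 0 < B -> 0 < A' -> 0 < B' ->
    A + B = A' + B' -> A * B < A' * B' ->
    0 < sg * (split_weight logistic th A' B' - split_weight logistic th A B)) ->
  (forall j, th < p 0 j) -> (forall j, th < q 0 j) ->
  dominates sg (prodf (normalized_mellin th) (row_seq p))
               (prodf (normalized_mellin th) (row_seq q)).
Proof.
move=> sg1 sw tp tq; have [qp sq sp pre tot] := hpq.
(* the exponents must exceed both 0 and th, a single lower bound *)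
pose m := Num.max 0 th.
have mE a : (m < a) = (0 < a) && (th < a) by rewrite /m gt_max.
have [] := @majorized_dom R (normalized_mellin th) m (dominates sg) _ _ _ n.+1
  (row_seq p) (row_seq q).
- exact: dominates_trans.
- by move=> a f g; rewrite mE => /andP[a0 ta]; exact: dominates_mul.
- move=> a b c d; rewrite !mE => /andP[a0 ta] /andP[b0 tb] /andP[c0 tc] /andP[d0 td].
  exact: dominates_pair.
- exact: size_row_seq.
- exact: size_row_seq.
- exact: sorted_row_seq.
- by apply: all_row_seq => j; rewrite mE hp tp.
- by apply: all_row_seq => j; rewrite mE hq tq.
- move=> k; case: k => [|k] kn; first by rewrite !take0 !big_nil.
  move: kn; rewrite leq_eqVlt ltnS => /predU1P[->|kn].
    by rewrite !take_oversize ?size_row_seq // !sum_row_seq tot.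
  by rewrite !sum_take_row_seq ?pre // ltnW.
- by rewrite !sum_row_seq tot.
(* sorted sequences that are rearrangements of each other are equal *)
- move=> pq; case: qp; apply: row_seq_inj; apply/esym.
  apply: (sorted_eq (leT := >=%R)) => //; try exact: sorted_row_seq.
    exact: rev_trans le_trans.
  by move=> x y /andP[h1 h2]; apply/eqP; rewrite eq_le; apply/andP.
- by [].
Qed.

Definition Gamma_shift (th : R) (r : 'rV[R]_n.+1) : R :=
  \prod_(j < n.+1) (Gamma (r 0 j - th) / Gamma (r 0 j)).

Lemma Gamma_shift_gt0 th (r : 'rV[R]_n.+1) : (forall j, 0 < r 0 j) -> (forall j, th < r 0 j) ->
  0 < Gamma_shift th r.
Proof.
by move=> r0 tr; apply: prodr_gt0 => j _; rewrite divr_gt0 ?Gamma_gt0 ?subr_gt0.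
Qed.

Lemma Gamma_coefE th : (forall j, th < p 0 j) -> (forall j, th < q 0 j) ->
  Gamma_coef p q th = Gamma_shift th p / Gamma_shift th q.
Proof.
move=> tp tq; rewrite /Gamma_coef /Gamma_shift -prodf_div; apply: eq_bigr => j _.
have : 0 < Gamma (p 0 j - th) by rewrite Gamma_gt0 ?subr_gt0.
have : 0 < Gamma (q 0 j - th) by rewrite Gamma_gt0 ?subr_gt0.
have := Gamma_gt0 (hp j); have := Gamma_gt0 (hq j).
move: (Gamma (p 0 j - th)) (Gamma (q 0 j - th)) => a b.
move: (Gamma (p 0 j)) (Gamma (q 0 j)) => c d d0 c0 b0 a0.
by field; rewrite !lt0r_neq0.
Qed.

Lemma prod_zetaE th (r : 'rV[R]_n.+1) x : (forall j, 0 < r 0 j) ->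
  (forall j, th < r 0 j) -> 0 < x ->
  \prod_(j < n.+1) alt_hurwitz_zeta (r 0 j) x =
  Gamma_shift th r * prodf (normalized_mellin th) (row_seq r) x.
Proof.
move=> r0 tr x0; rewrite prodf_row_seq /Gamma_shift -big_split; apply: eq_bigr => j _.
rewrite alt_hurwitz_zetaE // /normalized_mellin.
have : 0 < Gamma (r 0 j - th) by rewrite Gamma_gt0 ?subr_gt0.
have := Gamma_gt0 (r0 j).
move: (alt_mellin (r 0 j) x) => u; move: (Gamma (r 0 j - th)) => a.
by move: (Gamma (r 0 j)) => b b0 a0 /=; field; rewrite !lt0r_neq0.
Qed.

(** Dfun is Gamma_shift th p times the difference of the products of the
    normalised transforms. *)
Lemma signed_Dfun (th sg : R) : sg = 1 \/ sg = -1 ->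
  (forall A B A' B', 0 < A -> 0 < B -> 0 < A' -> 0 < B' ->
    A + B = A' + B' -> A * B < A' * B' ->
    0 < sg * (split_weight logistic th A' B' - split_weight logistic th A B)) ->
  (forall j, th < p 0 j) -> (forall j, th < q 0 j) ->
  cm (fun x => sg * Dfun p q th x) /\ forall x, 0 < x -> 0 < sg * Dfun p q th x.
Proof.
move=> sg1 sw tp tq; have [c l] := dominates_row sg1 sw tp tq.
have Cp := Gamma_shift_gt0 hp tp; have Cq := Gamma_shift_gt0 hq tq.
have E x : 0 < x -> Gamma_shift th p * (sg *
    (prodf (normalized_mellin th) (row_seq p) x -
     prodf (normalized_mellin th) (row_seq q) x)) = sg * Dfun p q th x.
  move=> x0; rewrite /Dfun Gamma_coefE // !(@prod_zetaE th) //.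
  move: (Gamma_shift th p) (Gamma_shift th q) Cp Cq => a b a0 b0.
  move: (prodf _ _ _) => u; move: (prodf _ _ _) => v.
  by field; exact: lt0r_neq0.
split; first by apply: eq_cm E (cmM (cm_cst (ltW Cp)) c).
by move=> x x0; rewrite -(E x x0); exact: mulr_gt0 Cp (l x x0).
Qed.

Lemma prod_zeta_gt0 (r : 'rV[R]_n.+1) x : (forall j, 0 < r 0 j) -> 0 < x ->
  0 < \prod_(j < n.+1) alt_hurwitz_zeta (r 0 j) x.
Proof. by move=> r0 x0; apply: prodr_gt0 => j _; exact: alt_hurwitz_zeta_gt0. Qed.

Lemma Gamma_coef0 : Gamma_coef p q 0 = 1.
Proof.
rewrite /Gamma_coef big1 // => j _; rewrite !subr0 (mulrC (Gamma (q 0 j))).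
by apply: divff; apply: lt0r_neq0; apply: mulr_gt0; exact: Gamma_gt0.
Qed.

(** The powers of x from [alt_hurwitz_zeta_bounds] cancel because p and q have
    the same sum. *)
Lemma zeta_ratio_le_inv (x : R) : 0 < x -> x < 1 ->
  (\prod_(j < n.+1) (1 - x `^ (q 0 j))) *
    ((\prod_(j < n.+1) alt_hurwitz_zeta (p 0 j) x) /
     (\prod_(j < n.+1) alt_hurwitz_zeta (q 0 j) x)) <= 1.
Proof.
move=> x0 x1; have Zq := prod_zeta_gt0 hq x0.
have powprod (r : 'rV[R]_n.+1) :
    \prod_(j < n.+1) x `^ (- r 0 j) = x `^ (- \sum_(j < n.+1) r 0 j).
  rewrite -sumrN; elim/big_rec2: _ => [|j a b _ ->]; first by rewrite powRr0.
  by rewrite powRD // (gt_eqF x0) implybT.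
have [_ _ _ _ tot] := hpq.
have le1 j : 0 <= 1 - x `^ q 0 j.
  have := ge0_ler_powR (ltW (hq j)) (ltW x0 : x \in Num.nneg) _ (ltW x1).
  by rewrite powR1 subr_ge0 nnegrE; exact.
rewrite mulrA ler_pdivrMr // mul1r.
apply: (@le_trans _ _ ((\prod_(j < n.+1) (1 - x `^ (q 0 j))) *
    \prod_(j < n.+1) x `^ (- p 0 j))).
  rewrite ler_wpM2l ?prodr_ge0 //; apply: ler_prod => j _.
  rewrite (ltW (alt_hurwitz_zeta_gt0 _ _)) //=.
  by have /andP[] := alt_hurwitz_zeta_bounds (hp j) x0.
rewrite powprod -tot -powprod -big_split /=; apply: ler_prod => j _.
have /andP[h _] := alt_hurwitz_zeta_bounds (hq j) x0.
by rewrite mulrC h andbT mulr_ge0 ?powR_ge0.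
Qed.

(** As x tends to 0 the product of the 1 - x^(q_j) tends to 1, so the ratio
    cannot stay above a constant c > 1. *)
Lemma lower_bound_sharp (c : R) : 1 < c ->
  ~ (forall x : R, 0 < x ->
       c < (\prod_(j < n.+1) alt_hurwitz_zeta (p 0 j) x) /
           (\prod_(j < n.+1) alt_hurwitz_zeta (q 0 j) x)).
Proof.
move=> c1 H.
have cv : (fun x : R => \prod_(j < n.+1) (1 - x `^ (q 0 j))) x @[x --> 0^'+] -->
    \prod_(j < n.+1) (1 - 0 : R).
  apply: (@cvg_big R 'I_n.+1 *%R 1 xpredT (@mul_continuous R) R (0 : R)^'+ _
    (fun j x => 1 - x `^ (q 0 j)) (fun=> 1 - 0) _ _) => j _.
  apply: cvgB; first exact: cvg_cst.
  exact: (powR_cvg0 (hq j)).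
rewrite big1 in cv; last by move=> j _; rewrite subr0.
have c0 : 0 < c by rewrite (lt_trans _ c1).
have : \forall x \near (0 : R)^'+, c^-1 < \prod_(j < n.+1) (1 - x `^ (q 0 j)).
  by apply: (cvgr_gt _ cv); rewrite invf_lt1.
move=> near_c.
have [x [x0 x1 hx]] : exists x : R, [/\ 0 < x, x < 1 &
    c^-1 < \prod_(j < n.+1) (1 - x `^ (q 0 j))].
  near (0 : R)^'+ => x; exists x; split.
  - by near: x; exact: nbhs_right_gt.
  - by near: x; exact: nbhs_right_lt.
  - by near: x.
have := zeta_ratio_le_inv x0 x1; apply/negP; rewrite -ltNge.
have P0 : 0 < \prod_(j < n.+1) (1 - x `^ (q 0 j)).
  by apply: lt_trans hx; rewrite invr_gt0.
apply: (@lt_trans _ _ (\prod_(j < n.+1) (1 - x `^ (q 0 j)) * c)).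
  by rewrite -ltr_pdivrMr // div1r.
by rewrite ltr_pM2l // H.
Unshelve. all: by end_near. Qed.

End assembly.

Unset Implicit Arguments.
Close Scope classical_set_scope.
Theorem proposition4 (R : realType) (n : nat) (hn : (2 <= n.+1)%N)
    (p q : 'rV[R]_n.+1)
    (hp : forall j : 'I_n.+1, 0 < p 0 j) (hq : forall j : 'I_n.+1, 0 < q 0 j)
    (hpq : majorized p q) :
  [/\ (forall theta : R,
         0 <= theta -> theta < Num.min (p 0 ord_max) (q 0 ord_max) ->
         completely_monotonic `]0, +oo[ (fun x => Dfun p q theta x)),
      (forall theta : R, theta <= theta0 R ->
         completely_monotonic `]0, +oo[ (fun x => - Dfun p q theta x)),
      (forall vartheta theta : R,
         0 <= vartheta -> vartheta < Num.min (p 0 ord_max) (q 0 ord_max) ->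
         theta <= theta0 R ->
         forall x : R, 0 < x ->
           Gamma_coef p q vartheta <
             (\prod_(j < n.+1) alt_hurwitz_zeta (p 0 j) x) /
             (\prod_(j < n.+1) alt_hurwitz_zeta (q 0 j) x) /\
           (\prod_(j < n.+1) alt_hurwitz_zeta (p 0 j) x) /
             (\prod_(j < n.+1) alt_hurwitz_zeta (q 0 j) x) <
           Gamma_coef p q theta) &
      (forall c : R, Gamma_coef p q 0 < c ->
         ~ (forall x : R, 0 < x ->
              c < (\prod_(j < n.+1) alt_hurwitz_zeta (p 0 j) x) /
                  (\prod_(j < n.+1) alt_hurwitz_zeta (q 0 j) x)))].
Proof.
have theta0_lt0 : theta0 R < 0.
  have [t_gt0 _] := t0P R.
  rewrite /theta0 oppr_lt0; apply: divr_gt0.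
    by rewrite mulr_gt0 ?exprn_gt0 ?expR_gt0.
  by rewrite exprn_gt0 // addr_gt0 ?expR_gt0.
have lower th (th_ge0 : 0 <= th) :=
  signed_Dfun hp hq hpq (or_introl erefl) (split_weight_lt_ge0 th_ge0).
have upper th (hth : th <= theta0 R) :=
  signed_Dfun hp hq hpq (or_intror erefl) (split_weight_lt_le_theta0 hth)
    (fun j => lt_trans (le_lt_trans hth theta0_lt0) (hp j))
    (fun j => lt_trans (le_lt_trans hth theta0_lt0) (hq j)).
split.
- move=> th th0 /(min_last_lt hpq)[tp tq]; apply: cm_completely_monotonic.
  have [c _] := lower th th0 tp tq.
  by apply: eq_cm c => x _; rewrite mul1r.
- move=> th hth; apply: cm_completely_monotonic.
  have [c _] := upper th hth.
  by apply: eq_cm c => x _; rewrite mulN1r.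
- move=> vth th vth0 /(min_last_lt hpq)[tp tq] hth x x0.
  have Zq := prod_zeta_gt0 hq x0; split.
    have [_ /(_ x x0)] := lower vth vth0 tp tq.
    by rewrite mul1r /Dfun subr_gt0 ltr_pdivlMr.
  have [_ /(_ x x0)] := upper th hth.
  by rewrite mulN1r /Dfun opprB subr_gt0 ltr_pdivrMr.
- by move=> c; rewrite (Gamma_coef0 hp hq) => /(lower_bound_sharp hp hq hpq).
Qed.
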